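(* Let $\Pi$ be a finite simply laced diagram with labelling $\sigma:I\to V$ ($|I|\ge2$), let $c(\Pi)$ be its number of connected components, let $\mathrm{Spin}(\Pi)$ (with enveloping maps $\widetilde\tau_{ij}$) be the universal enveloping group of the standard $\mathrm{Spin}(2)$-amalgam $\mathcal A(\Pi,\mathrm{Spin}(2))$, and let $K(\Pi)$ (with enveloping maps $\tau_{ij}$) be the maximal compact subgroup of the simply connected split real Kac–Moody group of type $\Pi$, viewed as universal enveloping group of $\mathcal A(\Pi,\mathrm{SO}(2))$. Then there is a unique epimorphism $\rho_\Pi:\mathrm{Spin}(\Pi)\to K(\Pi)$ with $\rho_\Pi\circ\widetilde\tau_{ij}=\tau_{ij}\circ\rho_{ij}$ for all $i\ne j$, and $\ker\rho_\Pi$ is a central subgroup of $\mathrm{Spin}(\Pi)$ of order exactly $2^{c(\Pi)}$. In particular, for irreducible $\Pi$, $\rho_\Pi$ is a non-trivial two-fold central extension.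
   Context: $\mathrm{Spin}(m)$ lives in the Clifford algebra with $e_k^2=-1$, $e_ke_l=-e_le_k$; $\rho_m:\mathrm{Spin}(m)\to\mathrm{SO}(m)$ is the twisted adjoint representation (surjective, kernel $\{\pm1\}$). Standard amalgams for simply laced $\Pi$ with labelling $\sigma$: for $i<j$ adjacent, $\mathcal A(\Pi,\mathrm{SO}(2))$ has $G_{ij}=\mathrm{SO}(3)$ with connecting maps the upper-left and lower-right $2\times 2$ block embeddings $\varepsilon_{12},\varepsilon_{23}$, and $\mathcal A(\Pi,\mathrm{Spin}(2))$ has $\widetilde G_{ij}=\mathrm{Spin}(3)$ with $\widetilde\varepsilon_{12}(a+be_1e_2)=a+be_1e_2$, $\widetilde\varepsilon_{23}(a+be_1e_2)=a+be_2e_3$; for $i<j$ non-adjacent, $G_{ij}=\mathrm{SO}(2)\times\mathrm{SO}(2)$, $\widetilde G_{ij}=\mathrm{Spin}(2)\times\mathrm{Spin}(2)$ with embeddings into first (for $i$) and second (for $j$) factor. $\rho_{ij}:=\rho_3$ if $i,j$ adjacent and $\rho_{ij}:=\rho_2\times\rho_2$ otherwise. A universal enveloping group of an amalgam $\{G_{ij},\phi^i_{ij}\}$ is a group $G$ with homomorphisms $\tau_{ij}:G_{ij}\to G$ whose images generate $G$, with $\tau_{ij}\circ\phi^j_{ij}=\tau_{kj}\circ\phi^j_{kj}$ for pairwise distinct $i,j,k$, through which every other such family factors uniquely. $K(\Pi)$ is the subgroup of the simply connected split real Kac–Moody group $G(\Pi)$ fixed by the Cartan–Chevalley involution; it is a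 universal enveloping group of $\mathcal A(\Pi,\mathrm{SO}(2))$ with injective enveloping maps. *)

(* Defs.v *)
From mathcomp Require Import all_boot.
From Stdlib Require Import Reals ClassicalEpsilon.

Set Implicit Arguments.
Unset Strict Implicit.
Unset Printing Implicit Defensive.

Record Group := {
  gcar :> Type;
  gmul : gcar -> gcar -> gcar;
  gone : gcar;
  ginv : gcar -> gcar;
  gmulA : forall x y z, gmul x (gmul y z) = gmul (gmul x y) z;
  gmul1g : forall x, gmul gone x = x;
  gmulVg : forall x, gmul (ginv x) x = gone }.

Definition ghom (G H : Group) (f : G -> H) : Prop :=
  forall x y, f (@gmul G x y) = @gmul H (f x) (f y).

Inductive gen (H : Group) (S : H -> Prop) : H -> Prop :=
  | gen_base x : S x -> gen S x
  | gen_one : gen S (gone H)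
  | gen_mul x y : gen S x -> gen S y -> gen S (@gmul H x y)
  | gen_inv x : gen S x -> gen S (@ginv H x).

Fixpoint sumR (m : nat) (f : nat -> R) : R :=
  match m with O => 0%R | S m' => (sumR m' f + f m')%R end.

Definition Mat := nat -> nat -> R.

Definition mmul (m : nat) (A B : Mat) : Mat := fun i j =>
  if Nat.ltb i m && Nat.ltb j m then sumR m (fun k => (A i k * B k j)%R) else 0%R.

Definition mid (m : nat) : Mat := fun i j =>
  if Nat.ltb i m && Nat.eqb i j then 1%R else 0%R.

Definition minor (j : nat) (A : Mat) : Mat := fun r c =>
  A (S r) (if Nat.ltb c j then c else S c).

Fixpoint det (m : nat) (A : Mat) : R :=
  match m with
  | O => 1%R
  | S m' => sumR (S m') (fun j => (pow (-1) j * A O j * det m' (minor j A))%R)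
  end.

Definition transp (A : Mat) : Mat := fun i j => A j i.

Definition SO (m : nat) (A : Mat) : Prop :=
  (forall i j, (m <= i)%coq_nat \/ (m <= j)%coq_nat -> A i j = 0%R) /\
  mmul m (transp A) A = mid m /\ det m A = 1%R.

Definition eps12 (A : Mat) : Mat := fun i j =>
  if Nat.ltb i 2 && Nat.ltb j 2 then A i j
  else if Nat.eqb i 2 && Nat.eqb j 2 then 1%R else 0%R.

Definition eps23 (A : Mat) : Mat := fun i j =>
  if Nat.eqb i 0 && Nat.eqb j 0 then 1%R
  else if Nat.ltb 0 i && Nat.ltb i 3 && Nat.ltb 0 j && Nat.ltb j 3
       then A (i - 1)%coq_nat (j - 1)%coq_nat else 0%R.

(* The real Clifford algebra Cl(m) with e_k^2 = -1, e_k e_l = - e_l e_k *)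
(* An element is its coefficient function on basis blades; the blade   *)
(* e_{k1} ... e_{kr} (k1 < ... < kr, 1-based) is encoded by the bitmask *)
(* with bits k1-1, ..., kr-1 set.  Coefficients at masks >= 2^m are 0. *)
Definition Cl := nat -> R.

Fixpoint countn (m : nat) (f : nat -> bool) : nat :=
  match m with O => O | S m' => (countn m' f + (if f m' then 1 else 0))%coq_nat end.

(* number of transpositions needed to sort e_A e_B *)
Definition swaps (m A B : nat) : nat :=
  countn (m * m)%coq_nat (fun p =>
    let a := (p / m)%coq_nat in let b := (p mod m)%coq_nat in
    Nat.testbit A a && Nat.testbit B b && Nat.ltb b a).

(* e_A e_B = blade_sign m A B * e_(A xor B) *)
Definition blade_sign (m A B : nat) : R :=
  pow (-1) (swaps m A B + countn m (fun k => Nat.testbit A k && Nat.testbit B k)).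

Definition cmul (m : nat) (x y : Cl) : Cl := fun C =>
  if Nat.ltb C (Nat.pow 2 m) then
    sumR (Nat.pow 2 m) (fun A => (x A * y (Nat.lxor A C) * blade_sign m A (Nat.lxor A C))%R)
  else 0%R.

Definition cone : Cl := fun C => if Nat.eqb C 0 then 1%R else 0%R.

Definition cvec (m : nat) (v : nat -> R) : Cl := fun C =>
  sumR m (fun k => if Nat.eqb C (Nat.pow 2 k) then v k else 0%R).

Definition unitvec (m : nat) (v : nat -> R) : Prop :=
  sumR m (fun k => (v k * v k)%R) = 1%R.

Inductive is_spin (m : nat) : Cl -> Prop :=
  | spin_one : is_spin m cone
  | spin_step x u v : is_spin m x -> unitvec m u -> unitvec m v ->
      is_spin m (cmul m x (cmul m (cvec m u) (cvec m v))).

Definition calpha (m : nat) (x : Cl) : Cl := fun C =>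
  if Nat.odd (countn m (fun k => Nat.testbit C k)) then (- x C)%R else x C.

(* inverse in Cl(m) (for invertible x; chosen by Hilbert's epsilon) *)
Definition cinv (m : nat) (x : Cl) : Cl :=
  epsilon (inhabits (fun _ : nat => 0%R))
    (fun y => (forall C, (Nat.pow 2 m <= C)%coq_nat -> y C = 0%R) /\
              cmul m x y = cone /\ cmul m y x = cone).

(* twisted adjoint representation rho_m : Spin(m) -> SO(m):
   rho_m(x) v = alpha(x) v x^-1; column j is the image of e_(j+1) *)
Definition rho (m : nat) (x : Cl) : Mat := fun i j =>
  if Nat.ltb i m && Nat.ltb j m then
    cmul m (cmul m (calpha m x) (fun C => if Nat.eqb C (Nat.pow 2 j) then 1%R else 0%R))
           (cinv m x) (Nat.pow 2 i)
  else 0%R.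

(* the embeddings Spin(2) -> Spin(3): e1,e2 |-> e1,e2  resp.  e1,e2 |-> e2,e3,
   so a + b e1e2 |-> a + b e1e2  resp.  a + b e2e3 *)
Definition teps12 (x : Cl) : Cl := fun C => if Nat.ltb C 4 then x C else 0%R.
Definition teps23 (x : Cl) : Cl := fun C =>
  if Nat.odd C then 0%R else if Nat.ltb C 8 then x (C / 2)%coq_nat else 0%R.

Record RankOne := {
  Tv : Type; Pv : Tv -> Prop; mulv : Tv -> Tv -> Tv; onev : Tv;
  T3 : Type; P3 : T3 -> Prop; mul3 : T3 -> T3 -> T3;
  e12 : Tv -> T3; e23 : Tv -> T3 }.
Arguments Pv : clear implicits.  Arguments mulv : clear implicits.
Arguments onev : clear implicits. Arguments P3 : clear implicits.
Arguments mul3 : clear implicits. Arguments e12 : clear implicits.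
Arguments e23 : clear implicits.

Definition SORankOne : RankOne :=
  {| Tv := Mat; Pv := SO 2; mulv := mmul 2; onev := mid 2;
     T3 := Mat; P3 := SO 3; mul3 := mmul 3; e12 := eps12; e23 := eps23 |}.

Definition SpinRankOne : RankOne :=
  {| Tv := Cl; Pv := is_spin 2; mulv := cmul 2; onev := cone;
     T3 := Cl; P3 := is_spin 3; mul3 := cmul 3; e12 := teps12; e23 := teps23 |}.

(* the group G_ij attached to a pair, b = adjacency of i and j *)
Definition ET (S : RankOne) (b : bool) : Type :=
  if b then T3 S else (Tv S * Tv S)%type.

Definition PE (S : RankOne) (b : bool) : ET S b -> Prop :=
  match b return ET S b -> Prop with
  | true => P3 S
  | false => fun p => Pv S p.1 /\ Pv S p.2
  end.

Definition mulE (S : RankOne) (b : bool) : ET S b -> ET S b -> ET S b :=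
  match b return ET S b -> ET S b -> ET S b with
  | true => mul3 S
  | false => fun p q => (mulv S p.1 q.1, mulv S p.2 q.2)
  end.

(* embedding of G_i into G_ij for i < j (first slot) *)
Definition slot1 (S : RankOne) (b : bool) : Tv S -> ET S b :=
  match b return Tv S -> ET S b with
  | true => e12 S
  | false => fun x => (x, onev S)
  end.

(* embedding of G_j into G_ij for i < j (second slot) *)
Definition slot2 (S : RankOne) (b : bool) : Tv S -> ET S b :=
  match b return Tv S -> ET S b with
  | true => e23 S
  | false => fun x => (onev S, x)
  end.

Arguments PE : clear implicits.  Arguments mulE : clear implicits.
Arguments slot1 : clear implicits. Arguments slot2 : clear implicits.

Definition rhoE (b : bool) : ET SpinRankOne b -> ET SORankOne b :=
  match b return ET SpinRankOne b -> ET SORankOne b with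
  | true => rho 3
  | false => fun p => (rho 2 p.1, rho 2 p.2)
  end.

(* Standard amalgam over a diagram on 'I_n (edge relation e) and its   *)
(* enveloping groups.  The group G_{ij} = G_{ji} is indexed by the pair *)
(* with i < j; a family tau is only used at pairs a < b.               *)
Section Amalgam.
Variables (S : RankOne) (n : nat) (e : rel 'I_n).

(* tau_ij o phi^j_ij applied to x in G_j, for i <> j *)
Definition img (H : Type) (tau : forall a b : 'I_n, ET S (e a b) -> H)
    (i j : 'I_n) (x : Tv S) : H :=
  if (i < j)%N then tau i j (slot2 S (e i j) x) else tau j i (slot1 S (e j i) x).

Definition env_family (H : Group) (tau : forall a b : 'I_n, ET S (e a b) -> H) : Prop :=
  (forall a b : 'I_n, (a < b)%N -> forall x y,
      PE S (e a b) x -> PE S (e a b) y -> tau a b (mulE S (e a b) x y) = @gmul H (tau a b x) (tau a b y)) /\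
  (forall i j k : 'I_n, i != j -> j != k -> i != k ->
      forall x, Pv S x -> img tau i j x = img tau k j x).

Definition factors (G H : Group) (tau : forall a b : 'I_n, ET S (e a b) -> G)
    (tau' : forall a b : 'I_n, ET S (e a b) -> H) (f : G -> H) : Prop :=
  forall a b : 'I_n, (a < b)%N -> forall x, PE S (e a b) x -> f (tau a b x) = tau' a b x.

Definition is_universal_env (G : Group) (tau : forall a b : 'I_n, ET S (e a b) -> G) : Prop :=
  env_family tau /\
  (forall g, gen (fun h => exists (a b : 'I_n) x, (a < b)%N /\ PE S (e a b) x /\ h = tau a b x) g) /\
  (forall (H : Group) (tau' : forall a b : 'I_n, ET S (e a b) -> H),
     env_family tau' ->
     exists f : G -> H, ghom f /\ factors tau tau' f /\
       (forall f' : G -> H, ghom f' -> factors tau tau' f' -> forall g, f' g = f g)).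

Definition injective_env (G : Group) (tau : forall a b : 'I_n, ET S (e a b) -> G) : Prop :=
  forall a b : 'I_n, (a < b)%N -> forall x y, PE S (e a b) x -> PE S (e a b) y -> tau a b x = tau a b y -> x = y.

End Amalgam.

Definition ncomp (n : nat) (e : rel 'I_n) : nat := n_comp e 'I_n.

(* Main.v *)
(** Let z_i be the image in Spin(Pi) of -1 in the i-th copy of Spin(2). Each z_i is a
    central involution in the kernel of rho_Pi, and z_i = z_j along edges because both
    embeddings Spin(2) -> Spin(3) send -1 to -1. As rho_3 and rho_2 are surjective with
    kernel {1,-1}, the quotient of Spin(Pi) by the subgroup generated by the z_i receives an
    enveloping family of the SO(2)-amalgam; by universality of K(Pi) this subgroup is all of
    ker rho_Pi, so it has order at most 2^c. For equality, fix a component and operators X_i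
    with X_i^2 = -1 that anticommute along edges and commute otherwise: letting e_1 e_2 in
    the i-th Spin(2) act as X_i for i in the component, and trivially elsewhere, gives a
    representation of Spin(Pi) in which z_i acts as -1 exactly when i lies in the component. *)

From Stdlib Require Import ClassicalEpsilon FunctionalExtensionality ProofIrrelevance PropExtensionality.
From Stdlib Require Import Lra Nsatz.
Require Import Defs.
From mathcomp Require Import all_boot.
From Stdlib Require Import Reals List.

Local Notation "x ## y" := (gmul x y) (at level 40, left associativity).
Local Notation Sp := SpinRankOne.

Ltac evalR := cbv -[Rplus Rmult Rminus Ropp Rinv IZR].
Ltac blades8 := let C := fresh "C" in
  apply: functional_extensionality => C;
  do 8 (destruct C as [|C]; [evalR; try ring|]); evalR; try reflexivity.

Tactic Notation "entries" int_or_var(n) "by" tactic3(t) :=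
  let i := fresh "i" in let j := fresh "j" in
  apply: functional_extensionality => i; apply: functional_extensionality => j;
  do n (destruct i as [|i];
    [do n (destruct j as [|j]; [evalR; solve [t]|]); evalR; reflexivity|]);
  destruct j; evalR; reflexivity.

(** * Coordinates on Spin(2) and Spin(3) *)

Section Coordinates.
Local Open Scope R_scope.

(* q2 a b is a + b e1e2, and q3 a b c d is a + b e1e2 + c e1e3 + d e2e3. *)
Definition q2 (a b : R) : Cl := fun C =>
  match C with 0 => a | 3 => b | _ => 0%R end.
Definition q3 (a b c d : R) : Cl := fun C =>
  match C with 0 => a | 3 => b | 5 => c | 6 => d | _ => 0%R end.

Lemma q3_mul a b c d a' b' c' d' :
  cmul 3 (q3 a b c d) (q3 a' b' c' d') =
  q3 (a * a' - b * b' - c * c' - d * d') (a * b' + b * a' + c * d' - d * c')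
     (a * c' + c * a' - b * d' + d * b') (a * d' + d * a' + b * c' - c * b').
Proof. blades8. Qed.

Lemma q2_mul a b a' b' :
  cmul 2 (q2 a b) (q2 a' b') = q2 (a * a' - b * b') (a * b' + b * a').
Proof. blades8. Qed.

Lemma cvec_mul3 u v : cmul 3 (cvec 3 u) (cvec 3 v) =
  q3 (- (u 0%nat * v 0%nat + u 1%nat * v 1%nat + u 2%nat * v 2%nat)) (u 0%nat * v 1%nat - u 1%nat * v 0%nat)
     (u 0%nat * v 2%nat - u 2%nat * v 0%nat) (u 1%nat * v 2%nat - u 2%nat * v 1%nat).
Proof. blades8. Qed.

Lemma cvec_mul2 u v : cmul 2 (cvec 2 u) (cvec 2 v) =
  q2 (- (u 0%nat * v 0%nat + u 1%nat * v 1%nat)) (u 0%nat * v 1%nat - u 1%nat * v 0%nat).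
Proof. blades8. Qed.

Lemma cmulA3 x y z : cmul 3 (cmul 3 x y) z = cmul 3 x (cmul 3 y z).
Proof. blades8. Qed.
Lemma cmulA2 x y z : cmul 2 (cmul 2 x y) z = cmul 2 x (cmul 2 y z).
Proof. blades8. Qed.

Lemma cone_q2 : cone = q2 1 0.
Proof. blades8. Qed.
Lemma cone_q3 : cone = q3 1 0 0 0.
Proof. blades8. Qed.
Lemma teps12_q2 a b : teps12 (q2 a b) = q3 a b 0 0.
Proof. blades8. Qed.
Lemma teps23_q2 a b : teps23 (q2 a b) = q3 a 0 0 b.
Proof.
apply: functional_extensionality => C; do 8 (destruct C as [|C]; [by []|]).
by rewrite /teps23; case: Nat.odd.
Qed.

Lemma is_spin2P x : is_spin 2 x <-> exists a b, a * a + b * b = 1 /\ x = q2 a b.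
Proof.
split.
- elim=> {x} [|x u v _ [a [b [Hab ->]]]]; first by exists 1, 0; split; [ring|exact: cone_q2].
  rewrite /unitvec /= => Hu Hv; rewrite cvec_mul2 q2_mul; do 2 eexists; split; last by [].
  transitivity ((a * a + b * b) * (0 + u 0%nat * u 0%nat + u 1%nat * u 1%nat)
     * (0 + v 0%nat * v 0%nat + v 1%nat * v 1%nat)); first by ring.
  by rewrite Hab Hu Hv; ring.
- move=> [a [b [Hab ->]]].
  (* [a + b e1e2] is the product of the unit vectors [e1] and [- a e1 + b e2], because [e1] squares
     to -1. *)
  have := @spin_step 2 cone (fun k => if k is O then 1 else 0)
    (fun k => if k is O then - a else b) (spin_one 2).
  rewrite cvec_mul2 cone_q2 q2_mul /unitvec /=.
  have -> : 1 * - (1 * - a + 0 * b) - 0 * (1 * b - 0 * - a) = a by ring.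
  have -> : 1 * (1 * b - 0 * - a) + 0 * - (1 * - a + 0 * b) = b by ring.
  by apply; [ring | rewrite -Hab; ring].
Qed.

(** * Angles and the Euler factorisation of [Spin(3)] *)

Lemma half_angle c s : c * c + s * s = 1 ->
  exists g h, g * g + h * h = 1 /\ g * g - h * h = c /\ 2 * (g * h) = s.
Proof.
(* The generic witness is the half-angle cosine [g] with [h = s / (2 g)]; at [c = -1] this [g]
   vanishes and the quotient breaks down. *)
move=> H; have [Hc|Hc] := Req_dec c (-1).
  exists 0, 1; have Hs : s = 0 by nra.
  by subst; split; [ring|split; ring].
have Hp : 0 < (1 + c) / 2 by nra.
exists (sqrt ((1 + c) / 2)), (s / (2 * sqrt ((1 + c) / 2))).
have := sqrt_lt_R0 _ Hp; have := sqrt_sqrt _ (Rlt_le _ _ Hp).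
move: (sqrt _) => g Hgg Hg.
have Hhh : s / (2 * g) * (s / (2 * g)) = (1 - c) / 2.
  transitivity (s * s / (4 * (g * g))); first by field; lra.
  have -> : s * s = (1 + c) * (1 - c) by lra.
  by rewrite Hgg; field; lra.
by rewrite Hgg Hhh; split; [field|split; field; lra].
Qed.

(** At the origin [r = 0] with an arbitrary angle, so callers need no case distinction. *)
Lemma polar x y : exists r c s, c * c + s * s = 1 /\ x = r * c /\ y = r * s.
Proof.
have [H|H] := Req_dec (x * x + y * y) 0.
  by exists 0, 1, 0; split; [ring|split; nra].
have Hp : 0 < x * x + y * y by nra.
exists (sqrt (x * x + y * y)), (x / sqrt (x * x + y * y)), (y / sqrt (x * x + y * y)).
have := sqrt_lt_R0 _ Hp; have := sqrt_sqrt _ (Rlt_le _ _ Hp).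
move: (sqrt _) => g Hgg Hg.
split; last by split; field; lra.
transitivity ((x * x + y * y) / (g * g)); first by field; lra.
by rewrite Hgg; field; lra.
Qed.

Lemma q3_unit_euler a b c d : a * a + b * b + c * c + d * d = 1 ->
  exists x y w, [/\ is_spin 2 x, is_spin 2 y, is_spin 2 w &
    q3 a b c d = cmul 3 (teps23 x) (cmul 3 (teps12 y) (teps23 w))].
Proof.
move=> H.
(* q is a product of an element without e2e3-component and a rotor in the (e2,e3)-plane;
   the former is conjugate, by such a rotor, to an element of the first Spin(2). *)
have [r [al [be [Hu [Ha Hd]]]]] := polar a d.
have [p [co [si [Hv [Hb Hc]]]]] := polar (b * al - c * be) (c * al + b * be).
(* Moving the rotor [g + h e2e3] past [e1e2], which anticommutes with [e2e3], conjugates it. Its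
   angle therefore acts twice on the plane of [e1e2] and [e1e3], hence the half angle. *)
have [g [h [Hgh [Hco Hsi]]]] := half_angle co si Hv.
(* The last factor is the inverse of the first times [al + be e2e3], so that the two outer rotors
   multiply to [al + be e2e3]. *)
exists (q2 g h), (q2 r p), (q2 (g * al + h * be) (g * be - h * al)); split.
- by apply/is_spin2P; exists g, h.
- apply/is_spin2P; exists r, p; split=> //.
  have Hr : r * r = a * a + d * d.
    by rewrite Ha Hd -{1}(Rmult_1_r r) -Hu; nra.
  have Hp : p * p = b * b + c * c.
    transitivity (p * p * (co * co + si * si)); first by rewrite Hv; ring.
    transitivity ((p * co) * (p * co) + (p * si) * (p * si)); first by ring.
    rewrite -Hb -Hc.
    transitivity ((b * b + c * c) * (al * al + be * be)); first by ring.
    by rewrite Hu; ring.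
  by rewrite Hr Hp -H; ring.
- apply/is_spin2P; do 2 eexists; split; last by [].
  transitivity ((g * g + h * h) * (al * al + be * be)); first by ring.
  by rewrite Hgh Hu; ring.
- rewrite teps12_q2 !teps23_q2 !q3_mul.
  have Eb : b = p * co * al + p * si * be.
    rewrite -Hb -Hc; transitivity (b * (al * al + be * be)); [by rewrite Hu; ring|ring].
  have Ec : c = p * si * al - p * co * be.
    rewrite -Hb -Hc; transitivity (c * (al * al + be * be)); [by rewrite Hu; ring|ring].
  have -> : q3 a b c d = q3 (r * al * (g * g + h * h)) (p * co * al + p * si * be)
      (p * si * al - p * co * be) (r * be * (g * g + h * h)).
    by rewrite -Eb -Ec Hgh -Ha -Hd !Rmult_1_r.
  by rewrite -Hco -Hsi; congr q3; ring.
Qed.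

(** One direction is multiplicativity of the norm. For the other, a unit quaternion is an Euler
    product, and each of its factors is a product of two unit vectors. *)
Lemma is_spin3P x : is_spin 3 x <->
  exists a b c d, a * a + b * b + c * c + d * d = 1 /\ x = q3 a b c d.
Proof.
split.
- elim=> {x} [|x u v _ [a [b [c [d [Hab ->]]]]]].
    by exists 1, 0, 0, 0; split; [ring|exact: cone_q3].
  rewrite /unitvec /= => Hu Hv; rewrite cvec_mul3 q3_mul; do 4 eexists; split; last by [].
  transitivity ((a * a + b * b + c * c + d * d) *
     (0 + u 0%nat * u 0%nat + u 1%nat * u 1%nat + u 2%nat * u 2%nat)
     * (0 + v 0%nat * v 0%nat + v 1%nat * v 1%nat + v 2%nat * v 2%nat)); first by ring.
  by rewrite Hab Hu Hv; ring.
- move=> [a [b [c [d [H ->]]]]] {x}.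
  have step1 x y : is_spin 3 x -> is_spin 2 y -> is_spin 3 (cmul 3 x (teps12 y)).
    move=> Hx /is_spin2P [p [q [Hpq ->]]].
    have := @spin_step 3 x (fun k => if k is O then 1 else 0)
      (fun k => match k with 0 => - p | 1 => q | _ => 0 end) Hx.
    rewrite cvec_mul3 teps12_q2 /unitvec /= => Hs.
    have -> : q3 p q 0 0 = q3 (- (1 * - p + 0 * q + 0 * 0)) (1 * q - 0 * - p)
       (1 * 0 - 0 * - p) (0 * 0 - 0 * q) by congr q3; ring.
    by apply: Hs; [ring | rewrite -Hpq; ring].
  have step2 x y : is_spin 3 x -> is_spin 2 y -> is_spin 3 (cmul 3 x (teps23 y)).
    move=> Hx /is_spin2P [p [q [Hpq ->]]].
    have := @spin_step 3 x (fun k => match k with 1 => 1 | _ => 0 end)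
      (fun k => match k with 0 => 0 | 1 => - p | _ => q end) Hx.
    rewrite cvec_mul3 teps23_q2 /unitvec /= => Hs.
    have -> : q3 p 0 0 q = q3 (- (0 * 0 + 1 * - p + 0 * q)) (0 * - p - 1 * 0)
       (0 * q - 0 * 0) (1 * q - 0 * - p) by congr q3; ring.
    by apply: Hs; [ring | rewrite -Hpq; ring].
  have [x [y [w [Hx Hy Hw ->]]]] := q3_unit_euler a b c d H.
  rewrite -cmulA3; apply: (step2 _ _ _ Hw); apply: (step1 _ _ _ Hy).
  move/is_spin2P: (Hx) => [p [q [_ E]]].
  have -> : teps23 x = cmul 3 cone (teps23 x).
    by rewrite E teps23_q2 cone_q3 q3_mul; congr q3; ring.
  by apply: (step2 _ _ _ Hx); apply: spin_one.
Qed.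

(** * Inverses and the matrices of the twisted adjoint representation *)

Lemma cinv_eq m x y : (forall u v w, cmul m (cmul m u v) w = cmul m u (cmul m v w)) ->
  (forall u, (forall C, (Nat.pow 2 m <= C)%coq_nat -> u C = 0) ->
     cmul m cone u = u /\ cmul m u cone = u) ->
  (forall C, (Nat.pow 2 m <= C)%coq_nat -> y C = 0) ->
  cmul m x y = cone -> cmul m y x = cone -> cinv m x = y.
Proof.
move=> A I Hy H1 H2.
have [Hz [H3 H4]] := epsilon_spec (inhabits (fun _ : nat => 0%R))
    (fun y => (forall C, (Nat.pow 2 m <= C)%coq_nat -> y C = 0%R) /\
              cmul m x y = cone /\ cmul m y x = cone)
    (ex_intro _ y (conj Hy (conj H1 H2))).
rewrite -/(cinv m x) in Hz H3 H4.
(* Uniqueness of two-sided inverses. The vanishing of coefficients from [2^m] on is what makes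
   [cone] neutral, since [cmul] truncates there. *)
by rewrite -[LHS](proj2 (I _ Hz)) -H1 -A H4 (proj1 (I _ Hy)).
Qed.

Lemma cmul2_cone u : (forall C, (Nat.pow 2 2 <= C)%coq_nat -> u C = 0) ->
  cmul 2 cone u = u /\ cmul 2 u cone = u.
Proof.
move=> H; split; apply: functional_extensionality => C;
 do 4 (destruct C as [|C]; [evalR; ring|]); (rewrite H; last by apply/leP); by evalR.
Qed.
Lemma cmul3_cone u : (forall C, (Nat.pow 2 3 <= C)%coq_nat -> u C = 0) ->
  cmul 3 cone u = u /\ cmul 3 u cone = u.
Proof.
move=> H; split; apply: functional_extensionality => C;
 do 8 (destruct C as [|C]; [evalR; ring|]); (rewrite H; last by apply/leP); by evalR.
Qed.

Lemma cinv_q2 a b : a * a + b * b = 1 -> cinv 2 (q2 a b) = q2 a (- b).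
Proof.
move=> H; apply: cinv_eq; [exact: cmulA2|exact: cmul2_cone| | |].
- by do 4 (case; first by move/leP).
- by rewrite q2_mul cone_q2; congr q2; [rewrite -H|]; ring.
- by rewrite q2_mul cone_q2; congr q2; [rewrite -H|]; ring.
Qed.

Lemma cinv_q3 a b c d : a * a + b * b + c * c + d * d = 1 ->
  cinv 3 (q3 a b c d) = q3 a (- b) (- c) (- d).
Proof.
move=> H; apply: cinv_eq; [exact: cmulA3|exact: cmul3_cone| | |].
- by do 8 (case; first by move/leP).
- by rewrite q3_mul cone_q3; congr q3; try (rewrite -H); ring.
- by rewrite q3_mul cone_q3; congr q3; try (rewrite -H); ring.
Qed.

Definition rot2 (c s : R) : Mat := fun i j =>
  match i, j with
  | 0, 0 => c | 0, 1 => - s | 1, 0 => s | 1, 1 => c | _, _ => 0 end.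

(** The Euler-Rodrigues matrix of the quaternion [a + b e1e2 + c e1e3 + d e2e3], homogeneous of
    degree two in its coordinates. *)
Definition rot3 (a b c d : R) : Mat := fun i j =>
  match i, j with
  | 0, 0 => a * a - b * b - c * c + d * d
  | 0, 1 => - 2 * (c * d) - 2 * (a * b)
  | 0, 2 => 2 * (b * d) - 2 * (a * c)
  | 1, 0 => - 2 * (c * d) + 2 * (a * b)
  | 1, 1 => a * a - b * b + c * c - d * d
  | 1, 2 => - 2 * (b * c) - 2 * (a * d)
  | 2, 0 => 2 * (b * d) + 2 * (a * c)
  | 2, 1 => - 2 * (b * c) + 2 * (a * d)
  | 2, 2 => a * a + b * b - c * c - d * d
  | _, _ => 0 end.

Lemma rho2E a b : a * a + b * b = 1 ->
  rho 2 (q2 a b) = rot2 (a * a - b * b) (2 * (a * b)).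
Proof. by move=> H; rewrite /rho cinv_q2 //; entries 2 by ring. Qed.

Lemma rho3E a b c d : a * a + b * b + c * c + d * d = 1 ->
  rho 3 (q3 a b c d) = rot3 a b c d.
Proof. by move=> H; rewrite /rho cinv_q3 //; entries 3 by ring. Qed.

Lemma rot2_mul c s c' s' :
  mmul 2 (rot2 c s) (rot2 c' s') = rot2 (c * c' - s * s') (c * s' + s * c').
Proof. entries 2 by ring. Qed.

Lemma rot3_mul a b c d a' b' c' d' :
  mmul 3 (rot3 a b c d) (rot3 a' b' c' d') =
  rot3 (a * a' - b * b' - c * c' - d * d') (a * b' + b * a' + c * d' - d * c')
     (a * c' + c * a' - b * d' + d * b') (a * d' + d * a' + b * c' - c * b').
Proof. entries 3 by ring. Qed.

Lemma rot2_SO c s : c * c + s * s = 1 -> SO 2 (rot2 c s).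
Proof.
move=> H; split; [|split].
- by move=> [|[|i]] [|[|j]] //= [] /leP.
- entries 2 by (rewrite -?H; ring).
- by evalR; rewrite -[RHS]H; ring.
Qed.

Lemma rot3_SO a b c d : a * a + b * b + c * c + d * d = 1 -> SO 3 (rot3 a b c d).
Proof.
move=> H.
(* With [N] the sum of the four squares, the columns are orthogonal of square length [N^2], and the
   determinant is [N^3]. *)
have H2 : (a * a + b * b + c * c + d * d) * (a * a + b * b + c * c + d * d) = 1.
  by rewrite H; ring.
split; [|split].
- by move=> [|[|[|i]]] [|[|[|j]]] //= [] /leP.
- entries 3 by (rewrite -?H2; ring).
- evalR.
  transitivity ((a * a + b * b + c * c + d * d) * ((a * a + b * b + c * c + d * d)
      * (a * a + b * b + c * c + d * d))); first by ring.
  by rewrite H2 H; ring.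
Qed.

(** * Surjectivity and kernels of [rho 2] and [rho 3] *)

Lemma SO2_rot A : SO 2 A -> exists c s, c * c + s * s = 1 /\ A = rot2 c s.
Proof.
move=> [Z [AO D]].
have E i j : mmul 2 (transp A) A i j = mid 2 i j by rewrite AO.
have := (E 0%nat 0%nat, E 0%nat 1%nat, E 1%nat 1%nat); move: D; evalR.
set a := A O O; set b := A O 1%nat; set c := A 1%nat O; set d := A 1%nat 1%nat.
move=> D [[E0 E1] E2].
(* The columns are orthonormal with determinant 1, so the second is the first turned by a right
   angle. *)
have Hd : d = a by clearbody a b c d; nsatz.
have Hb : b = - c by clearbody a b c d; nsatz.
exists a, c; split; first by rewrite -E0; ring.
apply: functional_extensionality => i; apply: functional_extensionality => j.
case: i => [|[|i]]; case: j => [|[|j]] //=; by apply: Z; (left + right); apply/leP.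
Qed.

Lemma rho2_surj A : SO 2 A -> exists2 x, is_spin 2 x & rho 2 x = A.
Proof.
move=> /SO2_rot [c [s [/half_angle [g [h [H [<- <-]]]] ->]]].
by exists (q2 g h); [apply/is_spin2P; exists g, h|rewrite rho2E].
Qed.

Lemma rot3_of_entries r s t u v w x y z :
  r * r + u * u + x * x = 1 -> r * s + u * v + x * y = 0 -> r * t + u * w + x * z = 0 ->
  s * s + v * v + y * y = 1 -> s * t + v * w + y * z = 0 -> t * t + w * w + z * z = 1 ->
  r * (v * z - w * y) - s * (u * z - w * x) + t * (u * y - v * x) = 1 ->
  exists a b c d, a * a + b * b + c * c + d * d = 1 /\
    [/\ r = rot3 a b c d 0%nat 0%nat, s = rot3 a b c d 0%nat 1%nat & t = rot3 a b c d 0%nat 2%nat] /\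
    [/\ u = rot3 a b c d 1%nat 0%nat, v = rot3 a b c d 1%nat 1%nat & w = rot3 a b c d 1%nat 2%nat] /\
    [/\ x = rot3 a b c d 2%nat 0%nat, y = rot3 a b c d 2%nat 1%nat & z = rot3 a b c d 2%nat 2%nat].
Proof.
move=> Err Ers Ert Ess Est Ett D.
(* A matrix in [SO(3)] is its own cofactor matrix, as its inverse is its transpose and its
   determinant is 1. *)
have C1 : v * z - w * y = r by nsatz.
have C2 : - (u * z - w * x) = s by nsatz.
have C3 : u * y - v * x = t by nsatz.
have C4 : - (s * z - t * y) = u by nsatz.
have C5 : r * z - t * x = v by nsatz.
have C6 : - (r * y - s * x) = w by nsatz.
have C7 : s * w - t * v = x by nsatz.
have C8 : - (r * w - t * u) = y by nsatz.
have C9 : r * v - s * u = z by nsatz.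
have F1 : r * r + s * s + t * t = 1 by nsatz.
have F2 : u * u + v * v + w * w = 1 by nsatz.
have F3 : x * x + y * y + z * z = 1 by nsatz.
have F4 : r * u + s * v + t * w = 0 by nsatz.
have F5 : r * x + s * y + t * z = 0 by nsatz.
have F6 : u * x + v * y + w * z = 0 by nsatz.
clear D.
(* The factors multiplied by [m] are the entries of [4 q q^T] for the quaternion [q] that is sought.
   A row of this matrix with diagonal entry [d] satisfies the equations with [m = 4 d], and division
   by [sqrt m] normalises it. *)
have key m p0 p1 p2 p3 : 0 < m ->
  [/\ 4 * (p0 * p0) = m * (1 + r + v + z), 4 * (p1 * p1) = m * (1 + z - r - v),
      4 * (p2 * p2) = m * (1 + v - r - z) & 4 * (p3 * p3) = m * (1 + r - v - z)] ->
  [/\ 4 * (p0 * p1) = m * (u - s), 4 * (p0 * p2) = m * (x - t) & 4 * (p0 * p3) = m * (y - w)] ->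
  [/\ 4 * (p1 * p2) = - m * (w + y), 4 * (p1 * p3) = m * (t + x) & 4 * (p2 * p3) = - m * (s + u)] ->
  exists a b c d, a * a + b * b + c * c + d * d = 1 /\
    [/\ r = rot3 a b c d 0%nat 0%nat, s = rot3 a b c d 0%nat 1%nat & t = rot3 a b c d 0%nat 2%nat] /\
    [/\ u = rot3 a b c d 1%nat 0%nat, v = rot3 a b c d 1%nat 1%nat & w = rot3 a b c d 1%nat 2%nat] /\
    [/\ x = rot3 a b c d 2%nat 0%nat, y = rot3 a b c d 2%nat 1%nat & z = rot3 a b c d 2%nat 2%nat].
  move=> Hm [H00 H11 H22 H33] [H01 H02 H03] [H12 H13 H23].
  have Hs := sqrt_lt_R0 _ Hm; have Hss := sqrt_sqrt _ (Rlt_le _ _ Hm).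
  have Q p q e : 4 * (p * q) = m * e -> 4 * ((p / sqrt m) * (q / sqrt m)) = e.
    move=> Hpq; transitivity (4 * (p * q) / (sqrt m * sqrt m)); first by field; lra.
    by rewrite Hpq Hss; field; lra.
  have N p q e : 4 * (p * q) = - m * e -> 4 * ((p / sqrt m) * (q / sqrt m)) = - e.
    by move=> Hpq; apply: Q; rewrite Hpq; ring.
  move: (Q _ _ _ H00) (Q _ _ _ H11) (Q _ _ _ H22) (Q _ _ _ H33) (Q _ _ _ H01) (Q _ _ _ H02)
    (Q _ _ _ H03) (N _ _ _ H12) (Q _ _ _ H13) (N _ _ _ H23).
  move: (p0 / _) (p1 / _) (p2 / _) (p3 / _) => a b c d *.
  (* The entries of [rot3] are linear in the ten products of two coordinates that are now known. *)
  exists a, b, c, d; rewrite /rot3; repeat split; lra.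
(* the four diagonal entries of the matrix [4 q q^T] sum to 4, so one is positive,
   and the corresponding row is a multiple of [q] *)
have [H|H1] := Rlt_le_dec 0 (1 + r + v + z).
  by apply: (key (4 * (1 + r + v + z)) (1 + r + v + z) (u - s) (x - t) (y - w));
    [lra| split; lra ..].
have [H|H2] := Rlt_le_dec 0 (1 + z - r - v).
  by apply: (key (4 * (1 + z - r - v)) (u - s) (1 + z - r - v) (- (w + y)) (t + x));
    [lra| split; lra ..].
have [H|H3] := Rlt_le_dec 0 (1 + v - r - z).
  by apply: (key (4 * (1 + v - r - z)) (x - t) (- (w + y)) (1 + v - r - z) (- (s + u)));
    [lra| split; lra ..].
by apply: (key (4 * (1 + r - v - z)) (y - w) (t + x) (- (s + u)) (1 + r - v - z));
    [lra| split; lra ..].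
Qed.

Lemma rho3_surj A : SO 3 A -> exists2 x, is_spin 3 x & rho 3 x = A.
Proof.
move=> [Z [AO D]].
have E i j : mmul 3 (transp A) A i j = mid 3 i j by rewrite AO.
have := @rot3_of_entries (A 0%nat 0%nat) (A 0%nat 1%nat) (A 0%nat 2%nat) (A 1%nat 0%nat) (A 1%nat 1%nat)
  (A 1%nat 2%nat) (A 2%nat 0%nat) (A 2%nat 1%nat) (A 2%nat 2%nat).
case; try by [rewrite -[RHS](E 0%nat 0%nat); evalR; ring|rewrite -[RHS](E 0%nat 1%nat); evalR; ring|
  rewrite -[RHS](E 0%nat 2%nat); evalR; ring|rewrite -[RHS](E 1%nat 1%nat); evalR; ring|
  rewrite -[RHS](E 1%nat 2%nat); evalR; ring|rewrite -[RHS](E 2%nat 2%nat); evalR; ring|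
  rewrite -[RHS]D; evalR; ring].
move=> a [b [c [d [H [[E1 E2 E3] [[E4 E5 E6] [E7 E8 E9]]]]]]].
exists (q3 a b c d); first by apply/is_spin3P; exists a, b, c, d.
rewrite rho3E //.
apply: functional_extensionality => i; apply: functional_extensionality => j.
case: i => [|[|[|i]]]; case: j => [|[|[|j]]] //=; symmetry; by apply: Z; (left + right); apply/leP.
Qed.

(** The double angle determines all products of two coordinates, hence the coordinate vector up to
    sign. *)
Lemma rho2_inj x y : is_spin 2 x -> is_spin 2 y -> rho 2 x = rho 2 y ->
  exists2 s, s = 1 \/ s = -1 & y = cmul 2 x (q2 s 0).
Proof.
move=> /is_spin2P [a [b [H ->]]] /is_spin2P [a' [b' [H' ->]]]; rewrite !rho2E // => E.
have := (f_equal (fun A : Mat => A 0%nat 0%nat) E, f_equal (fun A : Mat => A 1%nat 0%nat) E).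
rewrite /rot2 => [[E1 E2]] {E}.
have [? [? ?]] : a * a = a' * a' /\ b * b = b' * b' /\ a * b = a' * b' by split; lra.
clear E1 E2.
(* The sign is the inner product of the two unit coordinate vectors. *)
exists (a * a' + b * b').
  have : (a * a' + b * b' - 1) * (a * a' + b * b' - (-1)) = 0 by nsatz.
  by case/Rmult_integral => ?; [left|right]; lra.
by rewrite q2_mul; congr q2; nsatz.
Qed.

(** The matrix entries and the norm determine the ten products of two coordinates; the sign is again
    an inner product. *)
Lemma rho3_inj x y : is_spin 3 x -> is_spin 3 y -> rho 3 x = rho 3 y ->
  exists2 s, s = 1 \/ s = -1 & y = cmul 3 x (q3 s 0 0 0).
Proof.
move=> /is_spin3P [a [b [c [d [H ->]]]]] /is_spin3P [a' [b' [c' [d' [H' ->]]]]].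
rewrite !rho3E // => E.
have {}E i j := f_equal (fun A : Mat => A i j) E.
have := (E 0%nat 0%nat, E 0%nat 1%nat, E 0%nat 2%nat, E 1%nat 0%nat, E 1%nat 1%nat, E 1%nat 2%nat, E 2%nat 0%nat, E 2%nat 1%nat, E 2%nat 2%nat).
rewrite /rot3 => [[[[[[[[[E1 E2] E3] E4] E5] E6] E7] E8] E9]] {E}.
have [? ? ? ?] : [/\ a * a = a' * a', b * b = b' * b', c * c = c' * c' & d * d = d' * d'].
  by split; lra.
have [? ? ?] : [/\ a * b = a' * b', a * c = a' * c' & a * d = a' * d'] by split; lra.
have [? ? ?] : [/\ b * c = b' * c', b * d = b' * d' & c * d = c' * d'] by split; lra.
clear E1 E2 E3 E4 E5 E6 E7 E8 E9.
exists (a * a' + b * b' + c * c' + d * d').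
  have : (a * a' + b * b' + c * c' + d * d' - 1) *
         (a * a' + b * b' + c * c' + d * d' - (-1)) = 0 by nsatz.
  by case/Rmult_integral => ?; [left|right]; lra.
by rewrite q3_mul; congr q3; nsatz.
Qed.

(** * The groups attached to pairs of vertices *)

Lemma spin2_one : is_spin 2 cone. Proof. exact: spin_one. Qed.

Lemma spin2_sign s : s = 1 \/ s = -1 -> is_spin 2 (q2 s 0).
Proof. by move=> H; apply/is_spin2P; exists s, 0; split=> //; case: H => ->; ring. Qed.

Lemma spin2_mul x y : is_spin 2 x -> is_spin 2 y -> is_spin 2 (cmul 2 x y).
Proof.
move=> /is_spin2P [a [b [H ->]]] /is_spin2P [c [d [H' ->]]]; rewrite q2_mul.
apply/is_spin2P; do 2 eexists; split; last by [].
by rewrite -[RHS](Rmult_1_l 1) -{1}H -H'; ring.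
Qed.

Lemma spin2_comm x y : is_spin 2 x -> is_spin 2 y -> cmul 2 x y = cmul 2 y x.
Proof.
move=> /is_spin2P [a [b [_ ->]]] /is_spin2P [c [d [_ ->]]]; rewrite !q2_mul.
by congr q2; ring.
Qed.

Lemma cmul2_1l x : is_spin 2 x -> cmul 2 cone x = x.
Proof. by move=> /is_spin2P [a [b [_ ->]]]; rewrite cone_q2 q2_mul; congr q2; ring. Qed.
Lemma cmul2_1r x : is_spin 2 x -> cmul 2 x cone = x.
Proof. by move=> /is_spin2P [a [b [_ ->]]]; rewrite cone_q2 q2_mul; congr q2; ring. Qed.

Lemma spin3_mul x y : is_spin 3 x -> is_spin 3 y -> is_spin 3 (cmul 3 x y).
Proof.
move=> /is_spin3P [a [b [c [d [H ->]]]]] /is_spin3P [a' [b' [c' [d' [H' ->]]]]].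
rewrite q3_mul; apply/is_spin3P; do 4 eexists; split; last by [].
by rewrite -[RHS](Rmult_1_l 1) -{1}H -H'; ring.
Qed.

Lemma rho2_hom x y : is_spin 2 x -> is_spin 2 y ->
  rho 2 (cmul 2 x y) = mmul 2 (rho 2 x) (rho 2 y).
Proof.
move=> Hx Hy; have := spin2_mul _ _ Hx Hy.
move: Hx Hy => /is_spin2P [a [b [H ->]]] /is_spin2P [c [d [H' ->]]].
rewrite q2_mul => /is_spin2P [? [? [H2 E]]].
have [E0 E3] := (f_equal (@^~ O) E, f_equal (@^~ 3%nat) E); move: E0 E3 => /= E0 E3.
rewrite !rho2E // ?E0 ?E3 // rot2_mul -E0 -E3; congr rot2; ring.
Qed.

Lemma rho3_hom x y : is_spin 3 x -> is_spin 3 y ->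
  rho 3 (cmul 3 x y) = mmul 3 (rho 3 x) (rho 3 y).
Proof.
move=> /is_spin3P [a [b [c [d [H ->]]]]] /is_spin3P [a' [b' [c' [d' [H' ->]]]]].
rewrite q3_mul !rho3E // ?rot3_mul //.
by rewrite -[RHS](Rmult_1_l 1) -{1}H -H'; ring.
Qed.

Lemma rho2_SO x : is_spin 2 x -> SO 2 (rho 2 x).
Proof.
move=> /is_spin2P [a [b [H ->]]]; rewrite rho2E //; apply: rot2_SO.
by rewrite -[RHS](Rmult_1_l 1) -{1}H -H; ring.
Qed.

Lemma rho3_SO x : is_spin 3 x -> SO 3 (rho 3 x).
Proof.
by move=> /is_spin3P [a [b [c [d [H ->]]]]]; rewrite rho3E //; apply: rot3_SO.
Qed.

Lemma rho2_sign s : s = 1 \/ s = -1 -> rho 2 (q2 s 0) = mid 2.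
Proof.
move=> H; rewrite rho2E; last by case: H => ->; ring.
by entries 2 by (case: H => ->; ring).
Qed.

Lemma rho3_teps12 x : is_spin 2 x -> rho 3 (teps12 x) = eps12 (rho 2 x).
Proof.
move=> /is_spin2P [a [b [H ->]]]; rewrite teps12_q2 rho2E // rho3E.
  by entries 3 by (rewrite -?H; ring).
by rewrite -H; ring.
Qed.

Lemma rho3_teps23 x : is_spin 2 x -> rho 3 (teps23 x) = eps23 (rho 2 x).
Proof.
move=> /is_spin2P [a [b [H ->]]]; rewrite teps23_q2 rho2E // rho3E.
  by entries 3 by (rewrite -?H; ring).
by rewrite -H; ring.
Qed.

Lemma rhoE_PE b x : PE Sp b x -> PE SORankOne b (rhoE x).
Proof. by case: b x => /= [x|[x y] [Hx Hy]]; [apply: rho3_SO|split; apply: rho2_SO]. Qed.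

Lemma rhoE_hom b x y : PE Sp b x -> PE Sp b y ->
  rhoE (mulE Sp b x y) = mulE SORankOne b (rhoE x) (rhoE y).
Proof.
case: b x y => /= [x y|[x x'] [y y'] [Hx Hx'] [Hy Hy']]; first exact: rho3_hom.
by congr pair; apply: rho2_hom.
Qed.

Lemma rhoE_surj b A : PE SORankOne b A -> exists x, PE Sp b x /\ rhoE x = A.
Proof.
case: b A => [A /rho3_surj [x Hx <-]|[A B] [/= /rho2_surj [x Hx <-] /rho2_surj [y Hy <-]]].
  by exists x.
by exists (x, y).
Qed.

Lemma rhoE_slot1 b x : is_spin 2 x -> rhoE (slot1 Sp b x) = slot1 SORankOne b (rho 2 x).
Proof.
case: b => /= Hx; first exact: rho3_teps12.
by rewrite cone_q2 rho2_sign //; left.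
Qed.

Lemma rhoE_slot2 b x : is_spin 2 x -> rhoE (slot2 Sp b x) = slot2 SORankOne b (rho 2 x).
Proof.
case: b => /= Hx; first exact: rho3_teps23.
by rewrite cone_q2 rho2_sign //; left.
Qed.

Lemma slot1_PE b x : is_spin 2 x -> PE Sp b (slot1 Sp b x).
Proof.
case: b => /= Hx; last by split=> //; apply: spin_one.
move/is_spin2P: Hx => [a [c [H ->]]]; apply/is_spin3P; rewrite teps12_q2.
by do 4 eexists; split; last by []; rewrite -H; ring.
Qed.

Lemma slot2_PE b x : is_spin 2 x -> PE Sp b (slot2 Sp b x).
Proof.
case: b => /= Hx; last by split=> //; apply: spin_one.
move/is_spin2P: Hx => [a [c [H ->]]]; apply/is_spin3P; rewrite teps23_q2.
by do 4 eexists; split; last by []; rewrite -H; ring.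
Qed.

Lemma mulE_PE b x y : PE Sp b x -> PE Sp b y -> PE Sp b (mulE Sp b x y).
Proof.
case: b x y => /= [x y|[x x'] [y y'] /= [Hx Hx'] [Hy Hy']]; first exact: spin3_mul.
by split; apply: spin2_mul.
Qed.

Lemma slot1_mul b x y : is_spin 2 x -> is_spin 2 y ->
  slot1 Sp b (cmul 2 x y) = mulE Sp b (slot1 Sp b x) (slot1 Sp b y).
Proof.
case: b => /= Hx Hy; last by rewrite (cmul2_1l _ spin2_one).
move: Hx Hy => /is_spin2P [a [c [_ ->]]] /is_spin2P [a' [c' [_ ->]]].
by rewrite q2_mul !teps12_q2 q3_mul; congr q3; ring.
Qed.

Lemma slot2_mul b x y : is_spin 2 x -> is_spin 2 y ->
  slot2 Sp b (cmul 2 x y) = mulE Sp b (slot2 Sp b x) (slot2 Sp b y).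
Proof.
case: b => /= Hx Hy; last by rewrite (cmul2_1l _ spin2_one).
move: Hx Hy => /is_spin2P [a [c [_ ->]]] /is_spin2P [a' [c' [_ ->]]].
by rewrite q2_mul !teps23_q2 q3_mul; congr q3; ring.
Qed.

(** Adjacent vertices give the Euler product, the others a product with trivial third factor. The
    common shape reduces statements about pair groups to vertex groups. *)
Lemma PE_slots b x : PE Sp b x -> exists u v w, [/\ is_spin 2 u, is_spin 2 v, is_spin 2 w &
  x = mulE Sp b (slot2 Sp b u) (mulE Sp b (slot1 Sp b v) (slot2 Sp b w))].
Proof.
case: b x => /= [x /is_spin3P [a [b [c [d [H ->]]]]]|[x y] /= [Hx Hy]].
  exact: q3_unit_euler.
exists y, x, cone; split=> //; first exact: spin_one.
by rewrite /= !cmul2_1l ?cmul2_1r //; apply: spin_one.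
Qed.

(** For adjacent vertices both slots carry the same -1, so one sign suffices and [t] is set to 1;
    otherwise each factor contributes its own sign. *)
Lemma rhoE_inj b x y : PE Sp b x -> PE Sp b y -> rhoE x = rhoE y ->
  exists s t, [/\ s = 1 \/ s = -1, t = 1 \/ t = -1 &
    y = mulE Sp b x (mulE Sp b (slot1 Sp b (q2 s 0)) (slot2 Sp b (q2 t 0)))].
Proof.
case: b x y => /= [x y Hx Hy E|[x x'] [y y'] /= [Hx Hx'] [Hy Hy'] [E E']].
  have [s Hs ->] := rho3_inj _ _ Hx Hy E.
  exists s, 1; split=> //; first by left.
  by rewrite teps12_q2 teps23_q2 q3_mul; congr (cmul 3 x (q3 _ _ _ _)); ring.
have [s Hs ->] := rho2_inj _ _ Hx Hy E; have [t Ht ->] := rho2_inj _ _ Hx' Hy' E'.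
exists s, t; split=> //.
by rewrite cmul2_1l ?cmul2_1r //; apply: spin2_sign.
Qed.

Lemma slot1_sign_comm b s x : PE Sp b x ->
  mulE Sp b (slot1 Sp b (q2 s 0)) x = mulE Sp b x (slot1 Sp b (q2 s 0)).
Proof.
case: b x => /= [x /is_spin3P [a [b [c [d [H ->]]]]]|[x y] /= [/is_spin2P [a [b [_ ->]]] Hy]].
  by rewrite teps12_q2 !q3_mul; congr q3; ring.
by rewrite cmul2_1l // cmul2_1r // !q2_mul; congr (q2 _ _, _); ring.
Qed.

Lemma slot2_sign_comm b s x : PE Sp b x ->
  mulE Sp b (slot2 Sp b (q2 s 0)) x = mulE Sp b x (slot2 Sp b (q2 s 0)).
Proof.
case: b x => /= [x /is_spin3P [a [b [c [d [H ->]]]]]|[x y] /= [Hy /is_spin2P [a [b [_ ->]]]]].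
  by rewrite teps23_q2 !q3_mul; congr q3; ring.
by rewrite cmul2_1l // cmul2_1r // !q2_mul; congr (_, q2 _ _); ring.
Qed.

(** Both embeddings into [Spin(3)] fix scalars; this ties together the central involutions at the
    two ends of an edge. *)
Lemma slots_sign b s : b = true -> slot1 Sp b (q2 s 0) = slot2 Sp b (q2 s 0).
Proof. by move=> -> /=; rewrite teps12_q2 teps23_q2. Qed.

End Coordinates.

Local Notation sgn s := (q2 s 0%R).

(** * Groups and central quotients *)

Arguments ginv {g}.

Section GroupFacts.
Variable G : Defs.Group.
Implicit Types x y z : G.

Lemma gmulgV x : x ## ginv x = gone G.
Proof.
rewrite -(gmul1g (x ## ginv x)) -{1}(gmulVg (ginv x)) -gmulA (gmulA (ginv x)).
by rewrite gmulVg gmul1g gmulVg.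
Qed.

Lemma gmulg1 x : x ## gone G = x.
Proof. by rewrite -(gmulVg x) gmulA gmulgV gmul1g. Qed.

Lemma gmulKg x y : ginv x ## (x ## y) = y.
Proof. by rewrite gmulA gmulVg gmul1g. Qed.

Lemma gmulKVg x y : x ## (ginv x ## y) = y.
Proof. by rewrite gmulA gmulgV gmul1g. Qed.

Lemma gmulgI x y z : x ## y = x ## z -> y = z.
Proof. by move=> H; rewrite -(gmulKg x y) H gmulKg. Qed.

Lemma ginv_unique x y : x ## y = gone G -> y = ginv x.
Proof. by move=> H; apply: (gmulgI x); rewrite H gmulgV. Qed.

Lemma gidem x : x ## x = x -> x = gone G.
Proof. by move=> H; apply: (gmulgI x); rewrite gmulg1. Qed.

Lemma commute_gen (S : G -> Prop) z : (forall h, S h -> z ## h = h ## z) ->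
  forall h, gen S h -> z ## h = h ## z.
Proof.
move=> H h; elim=> {h}.
- by [].
- by rewrite gmulg1 gmul1g.
- by move=> x y _ Hx _ Hy; rewrite gmulA Hx -gmulA Hy gmulA.
- move=> x _ Hx; apply: (gmulgI x).
  by rewrite gmulKVg gmulA -Hx -gmulA gmulgV gmulg1.
Qed.

End GroupFacts.

Section Homs.
Variables (G H : Defs.Group) (f : G -> H).
Hypothesis f_hom : ghom f.

Lemma ghom1 : f (gone G) = gone H.
Proof. by apply: gidem; rewrite -f_hom gmul1g. Qed.

Lemma ghomV x : f (ginv x) = ginv (f x).
Proof. by apply: ginv_unique; rewrite -f_hom gmulgV ghom1. Qed.

Lemma ghom_onto (S : H -> Prop) : (forall h, gen S h) ->
  (forall h, S h -> exists x, f x = h) -> forall h, exists x, f x = h.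
Proof.
move=> gS HS h; elim: (gS h) => {h}.
- exact: HS.
- by exists (gone G); rewrite ghom1.
- by move=> x y _ [u <-] _ [v <-]; exists (u ## v); rewrite f_hom.
- by move=> x _ [u <-]; exists (ginv u); rewrite ghomV.
Qed.

Lemma ghom_eq_gen (f' : G -> H) (S : G -> Prop) : ghom f' -> (forall h, gen S h) ->
  (forall h, S h -> f h = f' h) -> forall h, f h = f' h.
Proof.
move=> f'_hom gS HS h; elim: (gS h) => {h}.
- exact: HS.
- by rewrite ghom1 -(gidem _ (f' (gone G))) // -f'_hom gmul1g.
- by move=> x y _ Hx _ Hy; rewrite f_hom f'_hom Hx Hy.
- move=> x _ Hx; rewrite ghomV; symmetry; apply: ginv_unique.
  by rewrite Hx -f'_hom gmulgV -(gidem _ (f' (gone G))) // -f'_hom gmul1g.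
Qed.

End Homs.

(* The quotient is carried by a chosen representative of each coset. *)
Lemma central_quotient (G : Defs.Group) (N : G -> Prop) :
  N (gone G) -> (forall x y, N x -> N y -> N (x ## y)) -> (forall x, N x -> N (ginv x)) ->
  (forall z x, N z -> z ## x = x ## z) ->
  exists (Q : Defs.Group) (p : G -> Q), ghom p /\ forall x y, p x = p y <-> N (ginv x ## y).
Proof.
move=> N1 NM NV NC.
pose rep x := epsilon (inhabits x) (fun y => N (ginv x ## y)).
have repP x : N (ginv x ## rep x).
  by apply: (epsilon_spec (inhabits x) (fun y => N (ginv x ## y))); exists x; rewrite gmulVg.
have invM (x y : G) : ginv (x ## y) = ginv y ## ginv x.
  symmetry; apply: ginv_unique.
  by rewrite -gmulA (gmulA y) gmulgV gmul1g gmulgV.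
have invK (x : G) : ginv (ginv x) = x by symmetry; apply: ginv_unique; rewrite gmulVg.
have Nsym x y : N (ginv x ## y) -> N (ginv y ## x).
  by move=> /NV; rewrite invM invK.
have Ntr x y z : N (ginv x ## y) -> N (ginv y ## z) -> N (ginv x ## z).
  by move=> Hxy Hyz; have := NM _ _ Hxy Hyz; rewrite -gmulA gmulKVg.
(* Congruent elements define the same coset predicate, so by extensionality the same element is
   chosen from it. *)
have rep_eq x y : N (ginv x ## y) -> rep x = rep y.
  move=> Hxy; rewrite /rep (proof_irrelevance _ (inhabits x) (inhabits y)).
  congr epsilon; apply: functional_extensionality => z; apply: propositional_extensionality.
  by split; apply: Ntr => //; apply: Nsym.
have rep_mod x y : rep x = rep y -> N (ginv x ## y).
  by move=> E; apply: (Ntr _ (rep x)) => //; rewrite E; apply: Nsym.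
have repK x : rep (rep x) = rep x by apply: rep_eq; apply: Nsym.
pose T := {x : G | rep x = x}.
pose p x : T := exist _ (rep x) (repK x).
have eqT (u v : T) : proj1_sig u = proj1_sig v -> u = v.
  case: u v => [u Hu] [v Hv] /= E; subst v; congr exist; exact: proof_irrelevance.
(* Centrality of [N] lets the discrepancy between [x] and [u] move past [v]. *)
have mod_mul x y u v : N (ginv x ## u) -> N (ginv y ## v) -> N (ginv (x ## y) ## (u ## v)).
  move=> Hx Hy; rewrite invM -(gmulA (ginv y)) (gmulA (ginv x)) (NC _ v Hx) gmulA.
  exact: NM.
pose mulT (u v : T) := p (proj1_sig u ## proj1_sig v).
pose invT (u : T) := p (ginv (proj1_sig u)).
have mulA u v w : mulT u (mulT v w) = mulT (mulT u v) w.
  apply: eqT => /=; transitivity (rep (proj1_sig u ## proj1_sig v ## proj1_sig w)).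
    rewrite -gmulA; apply: rep_eq; apply: mod_mul; first by rewrite gmulVg.
    exact: Nsym.
  by apply: rep_eq; apply: mod_mul => //; rewrite gmulVg.
have mul1 u : mulT (p (gone G)) u = u.
  apply: eqT => /=; rewrite -[RHS](proj2_sig u); apply: rep_eq.
  rewrite -{2}(gmul1g (proj1_sig u)); apply: mod_mul; last by rewrite gmulVg.
  exact: Nsym.
have mulV u : mulT (invT u) u = p (gone G).
  apply: eqT => /=; apply: rep_eq.
  rewrite -(gmulVg (proj1_sig u)); apply: mod_mul; last by rewrite gmulVg.
  exact: Nsym.
exists (Defs.Build_Group mulA mul1 mulV), p; split.
- move=> x y; apply: eqT => /=; apply: rep_eq; exact: mod_mul.
- by move=> x y; split=> [/(f_equal (@proj1_sig _ _))|H]; [apply: rep_mod | apply: eqT; apply: rep_eq].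
Qed.

(** * Anticommuting square roots of -1 *)

Section CliffordOperators.
Local Open Scope R_scope.
Variables (n : nat) (e : rel 'I_n).
Hypothesis e_sym : symmetric e.

Definition opV := ('I_n -> bool) -> R.
Implicit Types (v : opV) (i j k : 'I_n) (A : 'I_n -> bool).

(* A bilinear form over F_2 whose symmetrisation is the adjacency matrix and whose
   diagonal is 1: it is the cocycle of the twisted group algebra of F_2^n generated by
   square roots of -1 indexed by the vertices, which anticommute exactly along edges. *)
Definition form i k : bool := (i == k) || ((k < i)%nat && e i k).
Definition flip A i : 'I_n -> bool := fun k => A k (+) (k == i).
Definition bsgn (b : bool) : R := if b then -1 else 1.
Definition wt A i : bool := \big[addb/false]_k (form i k && A k).
(** A generator acting on functions on [F_2^n]: translation by the basis vector of [i], with the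
    sign that the cocycle assigns to [i] and [A]. *)
Definition root_op i v : opV := fun A => bsgn (wt A i) * v (flip A i).

Lemma bsgnD b c : bsgn (b (+) c) = bsgn b * bsgn c.
Proof. by case: b; case: c => /=; ring. Qed.

Lemma wt_flip A i j : wt (flip A j) i = wt A i (+) form i j.
Proof.
rewrite /wt /flip; under eq_bigr => k _ do rewrite andb_addr.
rewrite big_split /=; congr addb.
rewrite (bigD1 j) //= eqxx andbT big1 ?addbF // => k /negbTE ->.
by rewrite andbF.
Qed.

Lemma flipK A i : flip (flip A i) i = A.
Proof. by apply: functional_extensionality => k; rewrite /flip -addbA addbb addbF. Qed.

Lemma flipC A i j : flip (flip A i) j = flip (flip A j) i.
Proof. by apply: functional_extensionality => k; rewrite /flip -!addbA (addbC (k == i)). Qed.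

(** The two signs differ by the diagonal value [form i i], which is true. *)
Lemma root_opK i v A : root_op i (root_op i v) A = - v A.
Proof.
rewrite /root_op flipK wt_flip bsgnD /form eqxx /=.
by case: (wt A i) => /=; ring.
Qed.

Lemma form_sym i j : i != j -> form i j (+) form j i = e i j.
Proof.
move=> Hij; rewrite /form (eq_sym j i) (negbTE Hij) /= (e_sym j i).
case: (ltngtP i j) => [| |/val_inj E] /=; last by rewrite E eqxx in Hij.
  by [].
by rewrite addbF.
Qed.

(** Exchanging the two operators changes the sign by the symmetrised form, that is, by adjacency. *)
Lemma root_opC i j v A : i != j ->
  root_op i (root_op j v) A = bsgn (e i j) * root_op j (root_op i v) A.
Proof.
move=> Hij; rewrite /root_op flipC !wt_flip !bsgnD -form_sym // bsgnD.
by rewrite /bsgn; case: (form i j); case: (form j i); ring.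
Qed.

Definition op1 i (x : Cl) v : opV := fun A => x 0%nat * v A + x 3%nat * root_op i v A.

(* e1 e2 and e2 e3 act as the operators of i and j, hence e1 e3 = - (e1 e2)(e2 e3) *)
Definition op3 i j (x : Cl) v : opV := fun A =>
  x 0%nat * v A + x 3%nat * root_op i v A - x 5%nat * root_op i (root_op j v) A
  + x 6%nat * root_op j v A.

Lemma op1_mul i x y : is_spin 2 x -> is_spin 2 y ->
  op1 i (cmul 2 x y) = op1 i x \o op1 i y.
Proof.
move=> /is_spin2P [a [b [_ ->]]] /is_spin2P [c [d [_ ->]]]; rewrite q2_mul.
apply: functional_extensionality => v; apply: functional_extensionality => A /=.
rewrite /op1 /=.
have -> : root_op i (fun A0 => c * v A0 + d * root_op i v A0) A =
  c * root_op i v A + d * root_op i (root_op i v) A by rewrite /root_op; ring.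
by rewrite root_opK; ring.
Qed.

Lemma op1_comm i j x y : i != j -> ~~ e i j -> op1 i x \o op1 j y = op1 j y \o op1 i x.
Proof.
move=> Hij /negbTE He.
apply: functional_extensionality => v; apply: functional_extensionality => A /=.
have C := root_opC i j v A Hij; rewrite He /= in C.
rewrite /op1.
have -> : root_op i (fun A0 => y 0%nat * v A0 + y 3%nat * root_op j v A0) A =
  y 0%nat * root_op i v A + y 3%nat * root_op i (root_op j v) A by rewrite /root_op; ring.
have -> : root_op j (fun A0 => x 0%nat * v A0 + x 3%nat * root_op i v A0) A =
  x 0%nat * root_op j v A + x 3%nat * root_op j (root_op i v) A by rewrite /root_op; ring.
by rewrite C; ring.
Qed.

(** Let [I] and [J] be the operators of [i] and [j]. They are anticommuting square roots of -1, so
    [1], [I], [- I J], [J] multiply like [1], [e1e2], [e1e3], [e2e3]. *)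
Lemma op3_mul i j x y : i != j -> e i j -> is_spin 3 x -> is_spin 3 y ->
  op3 i j (cmul 3 x y) = op3 i j x \o op3 i j y.
Proof.
move=> Hij He /is_spin3P [a [b [c [d [_ ->]]]]] /is_spin3P [a' [b' [c' [d' [_ ->]]]]].
rewrite q3_mul.
apply: functional_extensionality => v; apply: functional_extensionality => A /=.
rewrite /op3 /=; set w := (fun A0 => a' * v A0 + _ - _ + _).
have C u B : root_op j (root_op i u) B = - root_op i (root_op j u) B.
  by rewrite (root_opC i j u B Hij) He /=; ring.
have L k B : root_op k w B = a' * root_op k v B + b' * root_op k (root_op i v) B
    - c' * root_op k (root_op i (root_op j v)) B + d' * root_op k (root_op j v) B.
  by rewrite /w /root_op; ring.
(* [J w] is written through [v], [I v], [J v] and [I J v] by moving every [I] to the left. *)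
have Lj : root_op j w = fun B => a' * root_op j v B - b' * root_op i (root_op j v) B
    - c' * root_op i v B - d' * v B.
  apply: functional_extensionality => B; rewrite L !C.
  have -> : root_op i (root_op j (root_op j v)) B = - root_op i v B.
    by rewrite {1}/root_op root_opK /root_op; ring.
  by rewrite root_opK; ring.
have -> : root_op i (root_op j w) A = a' * root_op i (root_op j v) A
   + b' * root_op j v A + c' * v A - d' * root_op i v A.
  rewrite Lj -[root_op j v A]Ropp_involutive -(root_opK i (root_op j v)).
  by rewrite -[v A]Ropp_involutive -(root_opK i v) /root_op; ring.
rewrite Lj L !root_opK; ring.
Qed.

Lemma op1_one i : op1 i cone = idfun.
Proof.
apply: functional_extensionality => v; apply: functional_extensionality => A.
by rewrite /op1 /cone /=; ring.
Qed.

Lemma op3_one i j : op3 i j cone = idfun.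
Proof.
apply: functional_extensionality => v; apply: functional_extensionality => A.
by rewrite /op3 /cone /=; ring.
Qed.

(** * Operators supported on the component with root [r] *)

Variable r : 'I_n.
Notation in_comp i := (root e i == r).

Definition cop1 i (x : Cl) : opV -> opV := if in_comp i then op1 i x else idfun.

(** Adjacent vertices share their component, so testing [i] alone decides for both. *)
Definition cop i j b : ET Sp b -> opV -> opV :=
  match b return ET Sp b -> opV -> opV with
  | true => fun x => if in_comp i then op3 i j x else idfun
  | false => fun p => cop1 i p.1 \o cop1 j p.2
  end.

Lemma cop1_mul i x y : is_spin 2 x -> is_spin 2 y ->
  cop1 i (cmul 2 x y) = cop1 i x \o cop1 i y.
Proof. by rewrite /cop1; case: ifP => // _; apply: op1_mul. Qed.

Lemma cop_mul i j b x y : i != j -> e i j = b -> PE Sp b x -> PE Sp b y ->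
  cop i j b (mulE Sp b x y) = cop i j b x \o cop i j b y.
Proof.
move=> Hij; case: b x y => /= [x y He Hx Hy|[x x'] [y y'] /= He [Hx Hx'] [Hy Hy']].
  by case: ifP => // _; apply: op3_mul.
rewrite !cop1_mul //.
(* Multiplication in the product group pairs [x] with [y] and [x'] with [y'], so the two inner
   operators have to be exchanged. *)
suff C : cop1 i y \o cop1 j x' = cop1 j x' \o cop1 i y.
  by apply: functional_extensionality => v /=; have /= -> := f_equal (@^~ (cop1 j y' v)) C.
rewrite /cop1; case: ifP => // _; case: ifP => // _.
by apply: op1_comm; rewrite ?He.
Qed.

Lemma spin2_invertible x : is_spin 2 x -> exists y, [/\ is_spin 2 y, cmul 2 x y = cone & cmul 2 y x = cone].
Proof.
move=> /is_spin2P [a [b [H ->]]]; exists (q2 a (- b)); split.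
- by apply/is_spin2P; exists a, (- b); split=> //; rewrite -H; ring.
- by rewrite q2_mul cone_q2; congr q2; rewrite -?H; ring.
- by rewrite q2_mul cone_q2; congr q2; rewrite -?H; ring.
Qed.

Lemma spin3_invertible x : is_spin 3 x -> exists y, [/\ is_spin 3 y, cmul 3 x y = cone & cmul 3 y x = cone].
Proof.
move=> /is_spin3P [a [b [c [d [H ->]]]]]; exists (q3 a (- b) (- c) (- d)); split.
- by apply/is_spin3P; exists a, (- b), (- c), (- d); split=> //; rewrite -H; ring.
- by rewrite q3_mul cone_q3; congr q3; rewrite -?H; ring.
- by rewrite q3_mul cone_q3; congr q3; rewrite -?H; ring.
Qed.

Lemma cop1_bij i x : is_spin 2 x -> bijective (cop1 i x).
Proof.
move=> Hx; have [y [Hy H1 H2]] := spin2_invertible x Hx.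
have E : cop1 i cone = idfun by rewrite /cop1 op1_one; case: ifP.
exists (cop1 i y) => v.
- by have /= <- := f_equal (@^~ v) (cop1_mul i _ _ Hy Hx); rewrite H2 E.
- by have /= <- := f_equal (@^~ v) (cop1_mul i _ _ Hx Hy); rewrite H1 E.
Qed.

Lemma cop_bij i j b x : i != j -> e i j = b -> PE Sp b x -> bijective (cop i j b x).
Proof.
move=> Hij; case: b x => [x He /= Hx|[x y] He [/= Hx Hy]]; last by apply: bij_comp; apply: cop1_bij.
have [y [Hy H1 H2]] := spin3_invertible x Hx.
case: ifP => _; last by exists idfun.
exists (op3 i j y) => v.
- by have /= <- := f_equal (@^~ v) (op3_mul i j _ _ Hij He Hy Hx); rewrite H2 op3_one.
- by have /= <- := f_equal (@^~ v) (op3_mul i j _ _ Hij He Hx Hy); rewrite H1 op3_one.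
Qed.

Lemma cop_slot1 i j b x : e i j = b -> is_spin 2 x -> cop i j b (slot1 Sp b x) = cop1 i x.
Proof.
case: b => /= He /is_spin2P [a [c [_ ->]]]; last first.
  by rewrite {2}/cop1 op1_one; case: ifP.
rewrite /cop1; case: ifP => // _; rewrite teps12_q2.
apply: functional_extensionality => v; apply: functional_extensionality => A.
by rewrite /op3 /op1 /=; ring.
Qed.

Lemma cop_slot2 i j b x : e i j = b -> is_spin 2 x -> cop i j b (slot2 Sp b x) = cop1 j x.
Proof.
case: b => /= He /is_spin2P [a [c [_ ->]]]; last first.
  by rewrite {1}/cop1 op1_one; case: ifP.
have -> : root e i = root e j.
  apply/eqP; rewrite root_connect ?connect1 //; exact: sym_connect_sym.
rewrite /cop1; case: ifP => // _; rewrite teps23_q2.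
apply: functional_extensionality => v; apply: functional_extensionality => A.
by rewrite /op3 /op1 /=; ring.
Qed.

Lemma cop1_minus i : cop1 i (sgn (-1)) = if in_comp i then (fun v A => - v A) else idfun.
Proof.
rewrite /cop1; case: ifP => // _.
apply: functional_extensionality => v; apply: functional_extensionality => A.
by rewrite /op1 /=; ring.
Qed.

End CliffordOperators.

(** * The group of bijections of a set *)

Section Bijections.
Variable V : Type.

Lemma bij_sig_eq (f g : {f : V -> V | bijective f}) : proj1_sig f = proj1_sig g -> f = g.
Proof. by case: f g => [f Hf] [g Hg] /= E; subst g; congr exist; apply: proof_irrelevance. Qed.

Definition bij_mul (f g : {f : V -> V | bijective f}) : {f : V -> V | bijective f} :=
  exist _ (proj1_sig f \o proj1_sig g) (bij_comp (proj2_sig f) (proj2_sig g)).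

Lemma bij_left_inverse (f : {f : V -> V | bijective f}) :
  exists g : {f : V -> V | bijective f}, proj1_sig g \o proj1_sig f = idfun.
Proof.
case: f => f [g fK gK]; have Hg : bijective g by exists f.
by exists (exist _ g Hg); apply: functional_extensionality => v /=; rewrite fK.
Qed.

Definition bij_inv f := proj1_sig (constructive_indefinite_description _ (bij_left_inverse f)).

Definition bij_one : {f : V -> V | bijective f} :=
  exist _ idfun (@Bijective V V idfun idfun (fun=> erefl) (fun=> erefl)).

Lemma bij_mulA f g h : bij_mul f (bij_mul g h) = bij_mul (bij_mul f g) h.
Proof. exact: bij_sig_eq. Qed.
Lemma bij_mul1 f : bij_mul bij_one f = f.
Proof. exact: bij_sig_eq. Qed.
Lemma bij_mulV f : bij_mul (bij_inv f) f = bij_one.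
Proof.
apply: bij_sig_eq; rewrite /bij_inv.
by case: constructive_indefinite_description.
Qed.

Definition SymGroup : Defs.Group := Defs.Build_Group bij_mulA bij_mul1 bij_mulV.

(** An enveloping family is a function on the whole ambient type, where operators outside the pair
    group may fail to be bijective; the identity serves as default. *)
Definition to_sym (f : V -> V) : SymGroup :=
  match excluded_middle_informative (bijective f) with
  | left Hf => exist _ f Hf
  | right _ => bij_one
  end.

Lemma to_symE f : bijective f -> proj1_sig (to_sym f) = f.
Proof. by rewrite /to_sym; case: excluded_middle_informative. Qed.

Lemma to_sym_comp f g : bijective f -> bijective g ->
  to_sym (f \o g) = gmul (to_sym f) (to_sym g).
Proof.
move=> Hf Hg; apply: bij_sig_eq; rewrite to_symE /=; last exact: bij_comp.
by rewrite !to_symE.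
Qed.

Lemma to_sym_id : to_sym idfun = gone SymGroup.
Proof. by apply: bij_sig_eq; rewrite to_symE //; exact: (proj2_sig bij_one). Qed.
End Bijections.

(** * The central involutions *)

Section Vertices.
Variables (n : nat) (e : rel 'I_n).
Hypotheses (e_sym : symmetric e) (Hn : (2 <= n)%N).

(** A vertex group enters the enveloping group only through a pair, so a second vertex is required;
    this is the use of [2 <= n]. *)
Lemma other_vertex (j : 'I_n) : exists i : 'I_n, i != j.
Proof.
have H0 : (0 < n)%N by apply: leq_trans Hn.
case: (eqVneq j (Ordinal H0)) => [->|Hj]; last by exists (Ordinal H0); rewrite eq_sym.
by exists (Ordinal Hn).
Qed.

Definition other (j : 'I_n) : 'I_n := xchoose (other_vertex j).
Lemma otherP j : other j != j. Proof. exact: xchooseP (other_vertex j). Qed.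

Variables (G : Defs.Group) (ttau : forall a b : 'I_n, ET Sp (e a b) -> G).
Hypothesis Hfam : env_family ttau.

Definition vert (j : 'I_n) (x : Cl) : G := img ttau (other j) j x.

(** Makes [vert] independent of the chosen partner. Compatibility in [env_family] concerns three
    distinct vertices, so the case where [i] is itself that partner is separate. *)
Lemma img_vert i j x : i != j -> is_spin 2 x -> img ttau i j x = vert j x.
Proof.
move=> Hij Hx; have [<-//|Hoi] := eqVneq (other j) i.
by apply: (proj2 Hfam); rewrite // 1?eq_sym ?otherP.
Qed.

Lemma ttau_slot1 (a b : 'I_n) x : (a < b)%N -> is_spin 2 x -> ttau a b (slot1 Sp (e a b) x) = vert a x.
Proof.
move=> Hab Hx; rewrite -(img_vert b) //; last by rewrite -val_eqE neq_ltn Hab orbT.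
by rewrite /img ltnNge (ltnW Hab).
Qed.

Lemma ttau_slot2 (a b : 'I_n) x : (a < b)%N -> is_spin 2 x -> ttau a b (slot2 Sp (e a b) x) = vert b x.
Proof.
move=> Hab Hx; rewrite -(img_vert a) //; last by rewrite -val_eqE neq_ltn Hab.
by rewrite /img Hab.
Qed.

Lemma ttau_verts (a b : 'I_n) x : (a < b)%N -> PE Sp (e a b) x ->
  exists u v w, [/\ is_spin 2 u, is_spin 2 v, is_spin 2 w &
    ttau a b x = vert b u ## (vert a v ## vert b w)].
Proof.
move=> Hab /PE_slots [u [v [w [Hu Hv Hw ->]]]]; exists u, v, w; split=> //.
have [Hm _] := Hfam.
have P1 := slot1_PE; have P2 := slot2_PE; have PM := mulE_PE.
by rewrite !Hm ?ttau_slot1 ?ttau_slot2 //; auto.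
Qed.

Lemma vert_mul j x y : is_spin 2 x -> is_spin 2 y ->
  vert j (cmul 2 x y) = vert j x ## vert j y.
Proof.
move=> Hx Hy; rewrite /vert /img; case: (ltnP (other j) j) => Hlt.
  rewrite slot2_mul // (proj1 Hfam) //; exact: slot2_PE.
have {}Hlt : (j < other j)%N by rewrite ltn_neqAle Hlt andbT eq_sym val_eqE otherP.
by rewrite slot1_mul // (proj1 Hfam) //; exact: slot1_PE.
Qed.

Lemma vert_one j : vert j cone = gone G.
Proof. by apply: gidem; rewrite -vert_mul ?cmul2_1l //; apply: spin_one. Qed.

Definition zvert j := vert j (sgn (-1)%R).

Lemma sgn_spin : is_spin 2 (sgn (-1)%R). Proof. by apply: spin2_sign; right. Qed.
Lemma sgn_sq : cmul 2 (sgn (-1)%R) (sgn (-1)%R) = cone.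
Proof. by rewrite q2_mul cone_q2; congr q2; ring. Qed.

Lemma zvert_sq j : zvert j ## zvert j = gone G.
Proof. by rewrite -vert_mul ?sgn_sq ?vert_one //; apply: sgn_spin. Qed.

(** For [i = j] this is commutativity of [Spin(2)]; otherwise both elements come from one pair
    group, in which the image of -1 is central. *)
Lemma zvert_vert i j x : is_spin 2 x -> zvert i ## vert j x = vert j x ## zvert i.
Proof.
move=> Hx; have Hs := sgn_spin.
have [->|Hij] := eqVneq i j; first by rewrite -!vert_mul // spin2_comm.
move: (Hij); rewrite -val_eqE neq_ltn => /orP [Hab|Hab].
  rewrite /zvert -(ttau_slot1 i j) // -(ttau_slot2 i j) // -!(proj1 Hfam) //;
    try by [apply: slot1_PE | apply: slot2_PE].
  by rewrite slot1_sign_comm //; apply: slot2_PE.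
rewrite /zvert -(ttau_slot2 j i) // -(ttau_slot1 j i) // -!(proj1 Hfam) //;
  try by [apply: slot1_PE | apply: slot2_PE].
by rewrite slot2_sign_comm //; apply: slot1_PE.
Qed.

Lemma zvert_ttau i (a b : 'I_n) x : (a < b)%N -> PE Sp (e a b) x ->
  zvert i ## ttau a b x = ttau a b x ## zvert i.
Proof.
move=> Hab /(ttau_verts a b x Hab) [u [v [w [Hu Hv Hw ->]]]].
rewrite gmulA zvert_vert // -!gmulA; congr gmul.
by rewrite gmulA zvert_vert // -!gmulA; congr gmul; apply: zvert_vert.
Qed.

Lemma zvert_edge i j : e i j -> zvert i = zvert j.
Proof.
have Hs := sgn_spin.
have lt_case (a b : 'I_n) : (a < b)%N -> e a b -> zvert a = zvert b.
  move=> Hab He; rewrite /zvert -(ttau_slot1 a b) // -(ttau_slot2 a b) //.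
  by rewrite slots_sign.
move=> He; case: (ltngtP i j) => [Hij|Hji|/val_inj ->//]; first exact: lt_case.
by symmetry; apply: lt_case; rewrite // e_sym.
Qed.

(** Equality along edges propagates along a path to the root, leaving at most one involution per
    component. *)
Lemma zvert_root i : zvert i = zvert (root e i).
Proof.
have /connectP [p] := connect_root e i; move: (root e i) => k.
elim: p i => [|j p IH] i /= => [_ ->//|/andP [/zvert_edge -> Hp] Hk].
exact: IH.
Qed.

End Vertices.

(** * Products of central involutions over subsets *)

Section CentralInvolutions.
Variables (T : eqType) (G : Defs.Group) (z : T -> G).
Hypotheses (z_central : forall i g, z i ## g = g ## z i)
  (z_sq : forall i, z i ## z i = gone G).

Definition zprod (s : list T) (S : pred T) : G :=
  foldr (fun i g => if S i then z i ## g else g) (gone G) s.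

Lemma zprod_central s S g : zprod s S ## g = g ## zprod s S.
Proof.
elim: s => [|i s IH] /=; first by rewrite gmul1g gmulg1.
by case: (S i) => //; rewrite -gmulA IH gmulA z_central -gmulA.
Qed.

(** An involution occurring in both factors cancels, so symmetric difference of subsets becomes
    multiplication. *)
Lemma zprod_mul s S S' : zprod s S ## zprod s S' = zprod s (fun i => S i (+) S' i).
Proof.
elim: s => [|i s IH] /=; first by rewrite gmul1g.
rewrite -IH; case: (S i) => /=; case: (S' i) => //=.
- by rewrite (z_central i (zprod s S')) -gmulA (gmulA (zprod s S)) -z_central gmulA z_sq gmul1g.
- by rewrite gmulA.
- by rewrite gmulA -z_central -gmulA.
Qed.

Lemma zprod0 s S : {in s, S =1 pred0} -> zprod s S = gone G.
Proof.
elim: s => //= i s IH H; rewrite H ?mem_head // IH // => j Hj.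
by rewrite H // inE Hj orbT.
Qed.

Lemma zprod1 s i : uniq s -> i \in s -> zprod s (pred1 i) = z i.
Proof.
elim: s => //= j s IH /andP [Hj Hs]; rewrite inE => /orP [/eqP E|Hi].
  rewrite E eqxx zprod0 ?gmulg1 // => k Hk /=.
  by apply/negbTE; apply: contraNneq Hj => <-.
by case: (eqVneq j i) Hj => [->|_ _]; [rewrite Hi|apply: IH].
Qed.

Lemma zprod_inv s S : ginv (zprod s S) = zprod s S.
Proof.
symmetry; apply: ginv_unique; rewrite zprod_mul zprod0 // => i _ /=.
by rewrite addbb.
Qed.

(** When [c] is nontrivial, the value tells whether [r] lies in [S]. The clause [r \in s] carries
    the induction over the list. *)
Lemma zprod_hom (H : Defs.Group) (f : G -> H) s (S : pred T) r c : ghom f -> uniq s ->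
  (forall i, i \in s -> S i -> f (z i) = if i == r then c else gone H) ->
  f (zprod s S) = if (r \in s) && S r then c else gone H.
Proof.
move=> Hf; elim: s => [|i s IH] /=; first by rewrite ghom1.
move=> /andP [Hi Hs] Hz.
have {}IH : f (zprod s S) = if (r \in s) && S r then c else gone H.
  by apply: IH => // j Hj; apply: Hz; rewrite inE Hj orbT.
have Hzi := Hz i (mem_head i s).
rewrite inE (eq_sym r); case: (eqVneq i r) Hzi => [E Hzi|_ Hzi] /=; case: ifP => HS.
- by rewrite Hf Hzi // IH -E (negbTE Hi) gmulg1 HS.
- by rewrite IH -E (negbTE Hi) HS.
- by rewrite Hf Hzi // gmul1g IH.
- exact: IH.
Qed.

End CentralInvolutions.

(** * Passing from [uniq] and [\in] to [NoDup] and [In] *)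

Lemma uniq_NoDup (T : eqType) (U : Type) (f : T -> U) (s : list T) :
  uniq s -> {in s &, injective f} -> NoDup [seq f x | x <- s].
Proof.
elim: s => [|x s IH] /=; first by constructor.
move=> /andP [Hx Hs] Hf; constructor; last first.
  by apply: IH => // y y' Hy Hy'; apply: Hf; rewrite inE ?Hy ?Hy' orbT.
move=> /in_map_iff [y [E Hy]]; case/negP: Hx.
have {}Hy : y \in s by elim: (s) Hy => //= a l IHl [->|/IHl H]; rewrite inE ?eqxx ?H ?orbT.
by rewrite -(Hf _ _ _ _ E) // inE ?eqxx ?Hy ?orbT.
Qed.

Lemma mem_In (T : eqType) (U : Type) (f : T -> U) (s : list T) x : x \in s -> In (f x) [seq f x | x <- s].
Proof.
by elim: s => //= a l IHl; rewrite inE => /orP [/eqP ->|/IHl]; [left|right].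
Qed.

Lemma In_mem (T : eqType) (U : Type) (f : T -> U) (s : list T) u :
  In u [seq f x | x <- s] -> exists2 x, x \in s & u = f x.
Proof.
elim: s => //= a l IHl [<-|/IHl [x Hx ->]]; first by exists a; rewrite ?mem_head.
by exists x; rewrite // inE Hx orbT.
Qed.

(** * The kernel *)

Lemma pow_expn m k : Nat.pow m k = expn m k.
Proof. by elim: k => //= k ->; rewrite expnS. Qed.

Section Main.
Variables (n : nat) (e : rel 'I_n).
Hypotheses (e_sym : symmetric e) (Hn : (2 <= n)%N).

(** Turns the [SO(2)]-family of [K(Pi)] into a test family for the universal property of [Spin(Pi)],
    which then yields [rho_Pi]. *)
Lemma rho_family (H : Defs.Group) (tau : forall a b : 'I_n, ET SORankOne (e a b) -> H) :
  env_family tau -> env_family (fun a b (x : ET Sp (e a b)) => tau a b (rhoE x)).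
Proof.
move=> [Hm Hc]; split.
  move=> a b Hab x y Hx Hy; rewrite rhoE_hom //.
  by apply: Hm => //; apply: rhoE_PE.
have Himg i j x : is_spin 2 x ->
    img (fun a b (x : ET Sp (e a b)) => tau a b (rhoE x)) i j x = img tau i j (rho 2 x).
  by move=> Hx; rewrite /img; case: ifP => _; rewrite ?rhoE_slot1 ?rhoE_slot2.
move=> i j k Hij Hjk Hik x Hx; rewrite !Himg //.
by apply: Hc => //; apply: rho2_SO.
Qed.

Section Kernel.
Variables (G K : Defs.Group)
  (ttau : forall a b : 'I_n, ET Sp (e a b) -> G)
  (tau : forall a b : 'I_n, ET SORankOne (e a b) -> K).
Hypotheses (HG : is_universal_env ttau) (HK : is_universal_env tau).
Variable f : G -> K.
Hypotheses (f_hom : ghom f)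
  (f_rho : forall a b : 'I_n, (a < b)%N -> forall x, PE Sp (e a b) x ->
     f (ttau a b x) = tau a b (rhoE x)).

Notation z := (zvert n e Hn G ttau).
Let Hfam : env_family ttau := proj1 HG.

Lemma z_central i g : z i ## g = g ## z i.
Proof.
apply: commute_gen (proj1 (proj2 HG) g) => _ [a [b [x [Hab [Hx ->]]]]].
exact: zvert_ttau.
Qed.

(** [rho 2] does not separate -1 from 1, and on each vertex group [f] depends only on the image
    under [rho 2]. *)
Lemma z_ker i : f (z i) = gone K.
Proof.
have Hs := sgn_spin.
have Hvert x y : is_spin 2 x -> is_spin 2 y -> rho 2 x = rho 2 y ->
    f (vert n e Hn G ttau i x) = f (vert n e Hn G ttau i y).
  move=> Hx Hy E; rewrite /vert /img; case: ltnP => Hlt.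
    by rewrite !f_rho ?rhoE_slot2 ?E //; apply: slot2_PE.
  have {}Hlt : (i < other n Hn i)%N by rewrite ltn_neqAle Hlt andbT eq_sym val_eqE otherP.
  by rewrite !f_rho ?rhoE_slot1 ?E //; apply: slot1_PE.
rewrite (Hvert _ cone) ?vert_one ?ghom1 //; first exact: spin_one.
by rewrite cone_q2 !rho2_sign //; [left|right].
Qed.

(** Modulo the involutions, elements with equal image under [rhoE] agree, so by universality of
    [K(Pi)] the projection [p] factors through [f]; hence the kernel of [f] lies in that of [p]. *)
Lemma ker_gen s : f s = gone K -> gen (fun h => exists i, h = z i) s.
Proof.
set N := gen _ => Hs.
have NC x g : N x -> x ## g = g ## x.
  move=> Hx; symmetry; apply: commute_gen Hx => _ [i ->]; symmetry; exact: z_central.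
have [Q [p [p_hom pE]]] := central_quotient G N (gen_one _) (@gen_mul _ _) (@gen_inv _ _) NC.
(* Preimages under [rhoE] are chosen arbitrarily; [p_rho] below shows that the choice is invisible
   in the quotient. *)
pose lift a b (y : ET SORankOne (e a b)) : ET Sp (e a b) :=
  epsilon (inhabits (slot1 Sp (e a b) cone)) (fun x => PE Sp (e a b) x /\ rhoE x = y).
have liftP a b y : PE SORankOne (e a b) y -> PE Sp (e a b) (lift a b y) /\ rhoE (lift a b y) = y.
  by move=> /rhoE_surj Hy; apply: (epsilon_spec (inhabits (slot1 Sp (e a b) cone)) (fun x => PE Sp (e a b) x /\ rhoE x = y)).
have Nsign i t : t = 1%R \/ t = (-1)%R -> N (vert n e Hn G ttau i (sgn t)).
  case=> ->; last by apply: gen_base; exists i.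
  by rewrite -cone_q2 vert_one //; apply: gen_one.
have p_rho (a b : 'I_n) x y : (a < b)%N -> PE Sp (e a b) x -> PE Sp (e a b) y ->
    rhoE x = rhoE y -> p (ttau a b x) = p (ttau a b y).
  move=> Hab Hx Hy /(rhoE_inj _ _ _ Hx Hy) [t [u [Ht Hu ->]]].
  have [St Su] := (spin2_sign _ Ht, spin2_sign _ Hu).
  have [S1 S2] := (slot1_PE (e a b) _ St, slot2_PE (e a b) _ Su).
  apply/pE; rewrite !(proj1 Hfam) //; last exact: mulE_PE.
  rewrite gmulKg ttau_slot1 // ttau_slot2 //.
  by apply: gen_mul; apply: Nsign.
pose tau' a b y := p (ttau a b (lift a b y)).
have tau'_rho (a b : 'I_n) x : (a < b)%N -> PE Sp (e a b) x -> tau' a b (rhoE x) = p (ttau a b x).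
  move=> Hab Hx; have [L1 L2] := liftP a b _ (rhoE_PE _ _ Hx).
  exact: p_rho.
have tau'_img i j x : i != j -> is_spin 2 x -> img tau' i j (rho 2 x) = p (img ttau i j x).
  move=> Hij Hx; rewrite /img; case: ltnP => Hlt.
    by rewrite -rhoE_slot2 // tau'_rho //; apply: slot2_PE.
  have {}Hlt : (j < i)%N by rewrite ltn_neqAle Hlt andbT eq_sym val_eqE.
  by rewrite -rhoE_slot1 // tau'_rho //; apply: slot1_PE.
have Hfam' : env_family tau'.
  split.
    move=> a b Hab x y Hx Hy.
    have [L1 L2] := liftP a b _ Hx; have [L3 L4] := liftP a b _ Hy.
    rewrite -{1}L2 -{1}L4 -rhoE_hom // tau'_rho //; last exact: mulE_PE.
    by rewrite (proj1 Hfam) // p_hom.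
  move=> i j k Hij Hjk Hik A /rho2_surj [x Hx <-].
  rewrite !tau'_img 1?(eq_sym k) //; congr p; exact: (proj2 Hfam).
have [g [g_hom [g_tau _]]] := proj2 (proj2 HK) Q tau' Hfam'.
(* Both sides are homomorphisms that agree on the generators [ttau a b x]. *)
have gf : forall s, g (f s) = p s.
  apply: (@ghom_eq_gen _ _ (fun s => g (f s)) _ p) (proj1 (proj2 HG)) _ => //.
    by move=> x y; rewrite f_hom g_hom.
  move=> _ [a [b [x [Hab [Hx ->]]]]].
  by rewrite f_rho // g_tau ?tau'_rho //; apply: rhoE_PE.
have : p (gone G) = p s by rewrite -(gf s) Hs !ghom1.
by move/pE; rewrite -(gmul1g (ginv _)) gmulgV gmul1g.
Qed.

(** Each involution equals the one at the root of its component, so sets of roots suffice as a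
    normal form for products of involutions. *)
Lemma ker_zprod s : f s = gone K <->
  exists2 S : {set 'I_n}, S \in powerset [set i | roots e i] &
    s = zprod _ _ z (enum 'I_n) (mem S).
Proof.
split; last first.
  case=> S _ ->; elim: (enum _) => /= [|i l IH]; first exact: ghom1.
  by case: (_ \in _); rewrite ?f_hom ?z_ker ?gmul1g.
move/ker_gen; elim=> {s}.
- move=> _ [i ->]; exists [set root e i].
    by rewrite powersetE sub1set inE roots_root //; apply: sym_connect_sym.
  rewrite zvert_root // -(zprod1 _ _ z (enum 'I_n)) ?enum_uniq ?mem_enum //.
  by congr zprod; apply: functional_extensionality => j /=; rewrite inE.
- exists set0; first by rewrite powersetE sub0set.
  by rewrite zprod0 // => i _ /=; rewrite inE.
- move=> x y _ [S HS ->] _ [S' HS' ->]; exists [set i | (i \in S) (+) (i \in S')].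
    rewrite powersetE; apply/subsetP => i; rewrite inE.
    move: HS HS'; rewrite !powersetE => /subsetP /(_ i) H /subsetP /(_ i) H'.
    by case: (i \in S) H => [H _|_]; [apply: H|apply: H'].
  rewrite zprod_mul //; [|exact: z_central|by move=> i; apply: zvert_sq].
  by congr zprod; apply: functional_extensionality => j /=; rewrite inE.
- move=> x _ [S HS ->]; exists S => //.
  by rewrite zprod_inv //; [exact: z_central|by move=> i; apply: zvert_sq].
Qed.

(** Universality of [Spin(Pi)] applied to the operators [cop] for the root [r]; the witness [c] is
    negation on [opV]. *)
Lemma z_detect r : exists (H : Defs.Group) (h : G -> H) (c : H), [/\ ghom h, c <> gone H &
  forall i, h (z i) = if root e i == r then c else gone H].
Proof.
pose V := opV n.
pose t a b (x : ET Sp (e a b)) : SymGroup V := to_sym V (cop n e r a b (e a b) x).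
have neq (a b : 'I_n) : (a < b)%N -> a != b by rewrite -val_eqE neq_ltn => ->.
have t_img i j x : i != j -> is_spin 2 x -> img t i j x = to_sym V (cop1 n e r j x).
  move=> Hij Hx; rewrite /img /t; case: ltnP => _; first by rewrite cop_slot2.
  by rewrite cop_slot1.
have t_fam : env_family t.
  split.
    move=> a b Hab x y Hx Hy; rewrite /t cop_mul ?neq //.
    by apply: to_sym_comp; apply: cop_bij; rewrite ?neq.
  by move=> i j k Hij Hjk Hik x Hx; rewrite !t_img // eq_sym.
have [h [h_hom [h_t _]]] := proj2 (proj2 HG) _ t t_fam.
exists (SymGroup V), h, (to_sym V (fun v A => - v A)%R); split=> //.
- move/(f_equal (@proj1_sig _ _)); rewrite to_symE; last first.
    by exists (fun v A => - v A)%R => v; apply: functional_extensionality => A; ring.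
  (* Negation and the identity are told apart by the constant function 1. *)
  move/(f_equal (fun F => F (fun=> 1%R) (fun=> true))) => /=; lra.
- move=> i; have Hs := sgn_spin.
  have -> : h (z i) = img t (other n Hn i) i (sgn (-1)%R).
    rewrite /zvert /vert /img; case: ltnP => Hlt; first by rewrite h_t //; apply: slot2_PE.
    have {}Hlt : (i < other n Hn i)%N by rewrite ltn_neqAle Hlt andbT eq_sym val_eqE otherP.
    by rewrite h_t //; apply: slot1_PE.
  by rewrite t_img ?otherP // cop1_minus; case: ifP => // _; apply: to_sym_id.
Qed.

(** For each root [r], the homomorphism of [z_detect] reads off from the product whether [r] belongs
    to the set. *)
Lemma zprod_inj :
  {in powerset [set i | roots e i] &, injective (fun S : {set 'I_n} => zprod _ _ z (enum 'I_n) (mem S))}.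
Proof.
move=> S S'; rewrite !powersetE => /subsetP HS /subsetP HS' E.
apply/setP => r.
have [Hr|Hr] := boolP (roots e r); last first.
  have out (T : {set 'I_n}) : {subset T <= [set i | roots e i]} -> (r \in T) = false.
    by move=> HT; apply: contraNF Hr => /HT; rewrite inE.
  by rewrite !out.
have [H [h [c [h_hom Hc hz]]]] := z_detect r.
have val (T : {set 'I_n}) : {subset T <= [set i | roots e i]} ->
    h (zprod _ _ z (enum 'I_n) (mem T)) = if r \in T then c else gone H.
  move=> HT; rewrite (zprod_hom _ _ z _ _ _ _ r c) ?enum_uniq ?mem_enum //.
  (* Elements of [T] are their own roots, so among them only [r] has its involution sent to [c]. *)
  by move=> i _ /HT; rewrite inE hz => /eqP ->.
have := val S HS; rewrite E val //.
by case: (r \in S); case: (r \in S') => // /esym // ?; exfalso; auto.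
Qed.

End Kernel.
End Main.

Theorem theorem1 (n : nat) (Hn : (2 <= n)%N) (e : rel 'I_n)
  (e_sym : symmetric e) (e_irr : irreflexive e)
  (SpinPi : Defs.Group)
  (ttau : forall a b : 'I_n, ET SpinRankOne (e a b) -> SpinPi)
  (HSpin : is_universal_env ttau)
  (KPi : Defs.Group)
  (tau : forall a b : 'I_n, ET SORankOne (e a b) -> KPi)
  (HK : is_universal_env tau)
  (HKinj : injective_env tau) :
  exists rhoPi : SpinPi -> KPi,
    ghom rhoPi /\
    (forall k : KPi, exists s : SpinPi, rhoPi s = k) /\
    (forall a b : 'I_n, (a < b)%N -> forall x, PE SpinRankOne (e a b) x ->
        rhoPi (ttau a b x) = tau a b (@rhoE (e a b) x)) /\
    (forall rho' : SpinPi -> KPi, ghom rho' ->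
       (forall a b : 'I_n, (a < b)%N -> forall x, PE SpinRankOne (e a b) x ->
          rho' (ttau a b x) = tau a b (@rhoE (e a b) x)) ->
       forall s, rho' s = rhoPi s) /\
    (forall z : SpinPi, rhoPi z = gone KPi ->
       forall g : SpinPi, gmul z g = gmul g z) /\
    (exists l : list SpinPi, NoDup l /\ length l = Nat.pow 2 (ncomp e) /\
       forall z : SpinPi, rhoPi z = gone KPi <-> In z l).
Proof.
(* Universality of [Spin(Pi)], tested on [tau] composed with [rhoE], gives existence and uniqueness
   at once. *)
have [f [f_hom [f_rho f_uniq]]] := proj2 (proj2 HSpin) KPi _ (rho_family n e _ tau (proj1 HK)).
exists f; split=> //; split; [|split=> //; split; [|split]].
(* The image contains the generators of [K(Pi)], since every element of a pair group lifts along
   [rhoE]. *)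
- apply: (ghom_onto _ _ f f_hom) (proj1 (proj2 HK)) _ => _ [a [b [y [Hab [Hy ->]]]]].
  by have [x [Hx <-]] := rhoE_surj _ _ Hy; exists (ttau a b x); apply: f_rho.
- by move=> rho' Hrho' H; apply: f_uniq.
- move=> z /(ker_zprod n e e_sym Hn _ _ ttau tau HSpin HK f f_hom f_rho) [S _ ->] g.
  by apply: zprod_central; apply: z_central.
(* The kernel is enumerated by the sets of component roots. *)
exists [seq zprod _ _ (zvert n e Hn SpinPi ttau) (enum 'I_n) (mem A) | A : {set 'I_n} <- enum (powerset [set i | roots e i])].
split; [|split].
- apply: uniq_NoDup; first exact: enum_uniq.
  by move=> S S'; rewrite !mem_enum; apply: zprod_inj.
- rewrite length_map -[length _]/(size _) -cardE card_powerset pow_expn; congr expn.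
  (* [n_comp] is by definition the number of roots. *)
  by apply: eq_card => i; rewrite !inE andbT.
- move=> z; rewrite (ker_zprod n e e_sym Hn _ _ ttau tau HSpin HK f f_hom f_rho).
  split=> [[S HS ->]|].
    by apply: (mem_In _ _ (fun S : {set 'I_n} => zprod _ _ _ _ (mem S))); rewrite mem_enum.
  by move/(In_mem _ _ _ _ _) => [S]; rewrite mem_enum; exists S.
Qed.
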